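(* Let $(G,d)$ be a metric space, $C\subset G$ a compact set, $(\mathbf X,\mathbb R,\mathbf X)$ a product triple, $\mu:\mathcal A\to[0,+\infty]$ a $\sigma$-finite regular measure, $\varphi:\mathbf X\to\mathbf X$ a convex function with $\varphi(0)=0$, and $f:G\to\mathbf X$ uniformly continuous on $G$ with $f(g)=0$ for all $g\in G\setminus C$. Let $h:G\to[0,+\infty)$ be a Lebesgue integrable function (with respect to $\mu$) such that $\int_Gh(g)\,d\mu(g)=1$ and $h$ is bounded on each subset $B\subset G$ with $\mu(B)<+\infty$. Then $$\varphi\Big(\int_Gh(g)f(g)\,d\mu(g)\Big)\le\int_Gh(g)\,\varphi(f(g))\,d\mu(g).$$
   Context: Conventions. All vector lattices are Dedekind complete. For such a lattice $Y$: $Y^+=\{y\in Y:y\ge 0\}$, $|y|=y\vee(-y)$, $\overline Y^+=Y^+\cup\{+\infty\}$ with order and operations extended in the natural way and $0\cdot(+\infty)=0$. An $(o)$-sequence in $Y$ is a decreasing sequence in $Y^+$ with infimum $0$. ''Definitely'' means for all but finitely many $n$. The supremum of an empty family of positive elements is $0$. Convergences. A convergence on $Y$ is a pair $(\mathcal S,\ell)$, where $\mathcal S$ is a linear subspace of the space of all sequences in $Y$ and $\ell:\mathcal S\to Y$ satisfies: (a) $\ell$ is linear; (b) if $(x_n),(y_n)\in\mathcal S$ and $x_n\le y_n$ definitely, then $\ell((x_n))\le\ell((y_n))$; (c) if $x_n=c$ definitely then $(x_n)\in\mathcal S$ and $\ell((x_n))=c$; if $(x_n)\in\mathcal S$ and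 $x_n\ne y_n$ for only finitely many $n$, then $(y_n)\in\mathcal S$ and $\ell((y_n))=\ell((x_n))$; (d) if $(x_n)\in\mathcal S$ then $(|x_n|)\in\mathcal S$ and $\ell((|x_n|))=|\ell((x_n))|$; (e) if $(x_n),(z_n)\in\mathcal S$, $\ell((x_n))=\ell((z_n))$ and $x_n\le y_n\le z_n$ definitely, then $(y_n)\in\mathcal S$; (f) for $u\in Y^+$, $(\frac1n u)_n\in\mathcal S$ and $\ell((\frac1n u)_n)=0$. Writing $\ell((x_n)_n)=c$ means that $(x_n)_n$ is a sequence in $Y$ belonging to $\mathcal S$ and that the value of $\ell$ is $c$. Limit superior. Each convergence $(\mathcal S,\ell)$ comes with a map $\overline\ell$ from the set of sequences in $Y^+$ to $\overline Y^+$ such that: (a) $\overline\ell((x_n))=\overline\ell((y_n))$ if $x_n=y_n$ definitely; (b) $\overline\ell((x_n+y_n))\le\overline\ell((x_n))+\overline\ell((y_n))$; (c) if $x_n\le y_n$ definitely then $\overline\ell((x_n))\le\overline\ell((y_n))$; (d) $\overline\ell((x_n))=\ell((x_n))$ if $(x_n)\in\mathcal S$; (e) if $\overline\ell((x_n))=0$ then $(x_n)\in\mathcal S$ and $\ell((x_n))=0$. Product triples. $(Y_1,Y_2,Y)$, with convergences $\ell_1,\ell_2,\ell$ (and $\overline\ell_1,\overline\ell_2,\overline\ell$), is a product triple if there is a map $\cdot:Y_1\times Y_2\to Y$ with: (1),(2) additivity in each variable; (3) $x_1\ge y_1$ and $x_2\ge0$ imply $x_1\cdot x_2\ge y_1\cdot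 x_2$; (4) $x_1\ge0$ and $x_2\ge y_2$ imply $x_1\cdot x_2\ge x_1\cdot y_2$; (5) if $(x_n)$ is an $(o)$-sequence in $Y_1$ and $y\in Y_2^+$, then $(x_n\cdot y)$ is an $(o)$-sequence; (6) if $x\in Y_1^+$ and $(y_n)$ is an $(o)$-sequence in $Y_2$, then $(x\cdot y_n)$ is an $(o)$-sequence; (7) $\ell_1((x_n))=0$, $y\in Y_2$ imply $\ell((x_n\cdot y))=0$; (8) $x\in Y_1$, $\ell_2((y_n))=0$ imply $\ell((x\cdot y_n))=0$; (9) $x_n\in Y_1^+$, $\overline\ell_1((x_n))=x$, $y\in Y_2^+$ imply $\overline\ell((x_n\cdot y))=x\cdot y$; (10) $x\in Y_1^+$, $y_n\in Y_2^+$, $\overline\ell_2((y_n))=y$ imply $\overline\ell((x\cdot y_n))=x\cdot y$. $Y$ is a product algebra if $(Y,Y,Y)$ is a product triple. Setting. $\mathbf X$ is a product algebra with convergence $\ell$, $\mathbb R$ carries a convergence $\ell_{\mathbb R}$, $(\mathbb R,\mathbf X,\mathbf X)$ and $(\mathbf X,\mathbb R,\mathbf X)$ are product triples; products of reals with elements of $\mathbf X$ are scalar multiplication. $\mathcal A$ is the $\sigma$-algebra of Borel subsets of the metric space $G$. $\mu:\mathcal A\to[0,+\infty]$ (finitely additive) is $\sigma$-finite if $G=\bigcup_nB_n$ with $B_n\in\mathcal A$, $\mu(B_n)<+\infty$; it is regular if $\mu(K)<+\infty$ for every compact $K\subset G$ and for every $\varepsilon>0$, $E\in\mathcal A$ there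 are a compact $K\subset E$ and an open $U\supset E$ with $\mu(U\setminus K)\le\varepsilon$ (regular finitely additive measures are $\sigma$-additive). Integral of $\mathbf X$-valued functions. $f:G\to\mathbf X$ is simple if $f=\sum_{j=1}^rc_j\chi_{A_j}$ with $c_j\in\mathbf X$, $A_j\in\mathcal A$, $\mu(A_j)<+\infty$; $\int_Af\,d\mu=\sum_jc_j\,\mu(A\cap A_j)$. $(f_n)_n$ converges in $\mu$-measure to $f$ on $A$ if there are $A_n\in\mathcal A$ with $\ell_{\mathbb R}((\mu(A\cap A_n))_n)=0$ and $\ell\big(\big(\bigvee_{g\in A\setminus A_n}|f_n(g)-f(g)|\big)_n\big)=0$. The integrals of simple $f_n$ are $\mu$-equiabsolutely continuous if (i) $\ell((\int_{A_n}|f_n|\,d\mu)_n)=0$ whenever $\ell_{\mathbb R}((\mu(A_n))_n)=0$, $A_n\in\mathcal A$; (ii) there is an increasing sequence $(B_m)_m$ in $\mathcal A$ of sets of finite measure with $\ell\big(\big(\overline\ell((\int_{G\setminus B_m}|f_n|\,d\mu)_n)\big)_m\big)=0$. A sequence of simple functions is defining for $f$ if it converges in $\mu$-measure to $f$ on every $A\in\mathcal A$ of finite measure and has $\mu$-equiabsolutely continuous integrals. A positive $f$ is integrable if there are a defining sequence $(f_n)_n$ and $l:\mathcal A\to\mathbf X$ with $\ell\big(\big(\bigvee_{A\in\mathcal A}|\int_Af_n\,d\mu-l(A)|\big)_n\big)=0$, and then $\int_Af\,d\mu:=l(A)$ (independent of choices); a general $f$ is integrable if $f^\pm$ are, with $\int_Af\,d\mu=\int_Af^+\,d\mu-\int_Af^-\,d\mu$.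 Uniform continuity. $f:G\to\mathbf X$ is uniformly continuous on $G$ if there is $u\in\mathbf X^+$ such that for each $\varepsilon>0$ there is $\delta>0$ with $|f(g_1)-f(g_2)|\le\varepsilon u$ whenever $d(g_1,g_2)\le\delta$. Convexity. $\varphi:\mathbf X\to\mathbf X$ is convex if for each $v\in\mathbf X$ there is $\beta_v\in\mathbf X$ with $\varphi(s)\ge\varphi(v)+\beta_v\cdot(s-v)$ for all $s\in\mathbf X$, and such that for every $u\in\mathbf X^+\setminus\{0\}$ the set $\{\beta_v:v\in[-u,u]\}$ is order bounded in $\mathbf X$, where $[-u,u]=\{v\in\mathbf X:-u\le v\le u\}$. *)

(* Defs.v *)
From HB Require Import structures.
From mathcomp Require Import all_boot all_order all_algebra.
From mathcomp Require Import all_classical all_reals all_analysis.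

Set Implicit Arguments.
Unset Strict Implicit.
Unset Printing Implicit Defensive.

Import Order.TTheory GRing.Theory Num.Theory.
Import numFieldNormedType.Exports.

Local Open Scope classical_set_scope.
Local Open Scope ring_scope.

(* The binary operations are fields of their own because the library has no
   common substructure of [zmodType] and [latticeType] through which
   [realDomainType] would inherit. *)
HB.mixin Record isDedekindVLattice (R : numDomainType) X of
    GRing.Lmodule R X & Num.POrderedZmodule X := {
  vjoin : X -> X -> X ;
  vmeet : X -> X -> X ;
  vle_joinl : forall x y z : X, (vjoin x y <= z) = (x <= z) && (y <= z) ;
  vle_meetr : forall x y z : X, (x <= vmeet y z) = (x <= y) && (x <= z) ;
  vleD2r : forall x y z : X, x <= y -> x + z <= y + z ;
  vscale_ge0 : forall (a : R) (x : X), 0 <= a -> 0 <= x -> 0 <= a *: x ;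
  vdedekind : forall E : set X,
    E !=set0 -> has_ubound E -> exists s : X, isLub E s
}.

#[short(type="dedekindVLatticeType")]
HB.structure Definition DedekindVLattice (R : numDomainType) :=
  { X of GRing.Lmodule R X & Num.POrderedZmodule X & isDedekindVLattice R X }.

Section real_line.
Variable R : realType.

Let real_le_joinl (x y z : R^o) :
  (Num.max x y <= z) = (x <= z) && (y <= z).
Proof. exact: ge_max. Qed.

Let real_le_meetr (x y z : R^o) :
  (x <= Num.min y z) = (x <= y) && (x <= z).
Proof. exact: le_min. Qed.

Let real_leD2r (x y z : R^o) : x <= y -> x + z <= y + z.
Proof. by rewrite lerD2r. Qed.

Let real_scale_ge0 (a : R) (x : R^o) : 0 <= a -> 0 <= x -> 0 <= a *: x.
Proof. by move=> a0 x0; exact: mulr_ge0. Qed.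

Let real_lub (E : set R^o) :
  E !=set0 -> has_ubound E -> exists s : R^o, isLub E s.
Proof.
move=> E0 Eub; exists (sup (E : set R)); split.
  by move=> x Ex; apply: ub_le_sup.
by move=> b Eb; apply: ge_sup.
Qed.

HB.instance Definition _ := Num.POrderedZmodule.on R^o.

HB.instance Definition _ := @isDedekindVLattice.Build R R^o
  _ _ real_le_joinl real_le_meetr real_leD2r real_scale_ge0 real_lub.

End real_line.

(* A point is needed because the measurable types of the library are pointed. *)
#[short(type="pmetricType")]
HB.structure Definition PointedMetric (R : numDomainType) :=
  { G of Metric R G & Pointed G }.

Notation borel G := (g_sigma_algebraType (@open G)).

Section vector_lattice.
Context {R : numDomainType} {X : dedekindVLatticeType R}.
Implicit Types (x y : X) (E : set X).

Definition vabs x : X := vjoin x (- x).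
Definition vpos x : X := vjoin x 0.
Definition vneg x : X := vjoin (- x) 0.

(* The supremum of a family of positive elements: the empty family has
   supremum 0, and an unbounded family has none. *)
Definition is_vsup E (s : X) : Prop :=
  (E = set0 /\ s = 0) \/ (E !=set0 /\ isLub E s).

Definition o_sequence (x : nat -> X) : Prop :=
  [/\ forall n, 0 <= x n,
      {homo x : m n / (m <= n)%N >-> n <= m} &
      infimums (range x) 0].

Definition order_bounded E : Prop := has_lbound E /\ has_ubound E.

End vector_lattice.

(* The extension of the positive cone of [Y] by a greatest element. *)
Inductive upper (Y : Type) : Type := Fin of Y | Infty.
Arguments Infty {Y}.

Section upper.
Context {R : numDomainType} {Y : dedekindVLatticeType R}.

Definition upper_le (a b : upper Y) : Prop :=
  match a, b with
  | _, Infty => True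
  | Fin x, Fin y => x <= y
  | Infty, Fin _ => False
  end.

Definition upper_add (a b : upper Y) : upper Y :=
  match a, b with
  | Fin x, Fin y => Fin (x + y)
  | _, _ => Infty
  end.

End upper.

(* Only the values of [cv_lim] on [cv_dom], and those of [cv_limsup] on
   sequences of positive elements, are meaningful. A sequence indexed by
   n = 1, 2, .. is a function on [nat] whose value at [n] is the term of index
   [n.+1]. *)
Record convergence (R : numFieldType) (Y : dedekindVLatticeType R) := Convergence {
  cv_dom : set (nat -> Y) ;
  cv_lim : (nat -> Y) -> Y ;
  cv_limsup : (nat -> Y) -> upper Y ;
  cv_linear : forall (a : R) x y, cv_dom x -> cv_dom y ->
    cv_dom (fun n => a *: x n + y n) /\
    cv_lim (fun n => a *: x n + y n) = a *: cv_lim x + cv_lim y ;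
  cv_mono : forall x y, cv_dom x -> cv_dom y ->
    (\forall n \near \oo, x n <= y n) -> cv_lim x <= cv_lim y ;
  cv_cst : forall x c, (\forall n \near \oo, x n = c) ->
    cv_dom x /\ cv_lim x = c ;
  cv_near : forall x y, cv_dom x -> (\forall n \near \oo, x n = y n) ->
    cv_dom y /\ cv_lim y = cv_lim x ;
  cv_abs : forall x, cv_dom x ->
    cv_dom (fun n => vabs (x n)) /\
    cv_lim (fun n => vabs (x n)) = vabs (cv_lim x) ;
  cv_squeeze : forall x y z, cv_dom x -> cv_dom z -> cv_lim x = cv_lim z ->
    (\forall n \near \oo, x n <= y n <= z n) -> cv_dom y ;
  cv_harmonic : forall u : Y, 0 <= u ->
    cv_dom (fun n => n.+1%:R^-1 *: u) /\
    cv_lim (fun n => n.+1%:R^-1 *: u) = 0 ;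
  cv_limsup_ge0 : forall x, (forall n, 0 <= x n) ->
    upper_le (Fin 0) (cv_limsup x) ;
  cv_limsup_near : forall x y,
    (forall n, 0 <= x n) -> (forall n, 0 <= y n) ->
    (\forall n \near \oo, x n = y n) -> cv_limsup x = cv_limsup y ;
  cv_limsupD : forall x y,
    (forall n, 0 <= x n) -> (forall n, 0 <= y n) ->
    upper_le (cv_limsup (fun n => x n + y n))
             (upper_add (cv_limsup x) (cv_limsup y)) ;
  cv_limsup_mono : forall x y,
    (forall n, 0 <= x n) -> (forall n, 0 <= y n) ->
    (\forall n \near \oo, x n <= y n) ->
    upper_le (cv_limsup x) (cv_limsup y) ;
  cv_limsup_dom : forall x, (forall n, 0 <= x n) -> cv_dom x ->
    cv_limsup x = Fin (cv_lim x) ;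
  cv_limsup0 : forall x, (forall n, 0 <= x n) -> cv_limsup x = Fin 0 ->
    cv_dom x /\ cv_lim x = 0
}.

Definition cv_to (R : numFieldType) (Y : dedekindVLatticeType R)
    (L : convergence Y) (x : nat -> Y) (c : Y) : Prop :=
  cv_dom L x /\ cv_lim L x = c.

(* In [pt_limsupl] and [pt_limsupr] the limit superior is finite: the product
   is not defined at infinity, and asking for infinity * y = infinity whenever
   y <> 0 would exclude coordinatewise products such as the one of R^2. *)
Record product_triple (R : numFieldType) (Y1 Y2 Y : dedekindVLatticeType R)
    (L1 : convergence Y1) (L2 : convergence Y2) (L : convergence Y)
    (mul : Y1 -> Y2 -> Y) : Prop := ProductTriple {
  pt_addl : forall x1 y1 x2, mul (x1 + y1) x2 = mul x1 x2 + mul y1 x2 ;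
  pt_addr : forall x1 x2 y2, mul x1 (x2 + y2) = mul x1 x2 + mul x1 y2 ;
  pt_monol : forall x1 y1 x2, y1 <= x1 -> 0 <= x2 -> mul y1 x2 <= mul x1 x2 ;
  pt_monor : forall x1 x2 y2, 0 <= x1 -> y2 <= x2 -> mul x1 y2 <= mul x1 x2 ;
  pt_oseql : forall x y, o_sequence x -> 0 <= y ->
    o_sequence (fun n => mul (x n) y) ;
  pt_oseqr : forall x y, 0 <= x -> o_sequence y ->
    o_sequence (fun n => mul x (y n)) ;
  pt_cvl : forall x y, cv_to L1 x 0 -> cv_to L (fun n => mul (x n) y) 0 ;
  pt_cvr : forall x y, cv_to L2 y 0 -> cv_to L (fun n => mul x (y n)) 0 ;
  pt_limsupl : forall x l y, (forall n, 0 <= x n) ->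
    cv_limsup L1 x = Fin l -> 0 <= y ->
    cv_limsup L (fun n => mul (x n) y) = Fin (mul l y) ;
  pt_limsupr : forall x y l, 0 <= x -> (forall n, 0 <= y n) ->
    cv_limsup L2 y = Fin l ->
    cv_limsup L (fun n => mul x (y n)) = Fin (mul x l)
}.

Definition product_algebra (R : numFieldType) (X : dedekindVLatticeType R)
    (L : convergence X) (mul : X -> X -> X) : Prop := product_triple L L L mul.

Section measure.
Context {R : realType} {G : pmetricType R}.
Implicit Types (mu : set (borel G) -> \bar R) (f : G -> R).

Definition regular mu : Prop :=
  (forall K : set G, compact K -> (mu K < +oo)%E) /\
  (forall (e : R) (E : set (borel G)), 0 < e -> measurable E ->
    exists K U : set G, [/\ compact K, K `<=` E, open U, E `<=` U &
                            (mu (U `\` K) <= e%:E)%E]).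

End measure.

Section vintegral.
Context {d : measure_display} {T : measurableType d} {R : realType}
  {X : dedekindVLatticeType R}.
Variables (L : convergence X) (LR : convergence (R^o : dedekindVLatticeType R)).
Variable mu : set T -> \bar R.
Implicit Types (f : T -> X) (A : set T).

Definition simple_repr (r : nat) (c : 'I_r -> X) (A : 'I_r -> set T) f : Prop :=
  (forall j, measurable (A j) /\ (mu (A j) < +oo)%E) /\
  (forall t, f t = \sum_(j < r) (\1_(A j) t : R) *: c j).

Definition simple f : Prop := exists r c B, @simple_repr r c B f.

(* The integral over [A] of a simple function does not depend on the
   representation of the function. *)
Definition simple_integral A f : X :=
  xget 0 [set v | exists r c B, @simple_repr r c B f /\
                  v = \sum_(j < r) fine (mu (A `&` B j)) *: c j].

Definition mu_null (A : nat -> set T) : Prop :=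
  (forall n, mu (A n) \is a fin_num) /\ cv_to LR (fun n => fine (mu (A n))) 0.

Definition cv_in_measure (fn : nat -> T -> X) f A : Prop :=
  exists B : nat -> set T,
    [/\ forall n, measurable (B n),
        mu_null (fun n => A `&` B n) &
        exists s : nat -> X,
          (forall n, is_vsup [set vabs (fn n t - f t) | t in A `\` B n] (s n)) /\
          cv_to L s 0].

Definition equi_abs_continuous (fn : nat -> T -> X) : Prop :=
  (forall A : nat -> set T, (forall n, measurable (A n)) -> mu_null A ->
     cv_to L (fun n => simple_integral (A n) (fun t => vabs (fn n t))) 0) /\
  (exists B : nat -> set T,
    [/\ forall m, measurable (B m) /\ (mu (B m) < +oo)%E,
        {homo B : m n / (m <= n)%N >-> m `<=` n} &
        exists s : nat -> X,
          (forall m, cv_limsup L (fun n =>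
             simple_integral (~` B m) (fun t => vabs (fn n t))) = Fin (s m)) /\
          cv_to L s 0]).

Definition defining (fn : nat -> T -> X) f : Prop :=
  [/\ forall n, simple (fn n),
      forall A, measurable A -> (mu A < +oo)%E -> cv_in_measure fn f A &
      equi_abs_continuous fn].

Definition is_pos_integral f (l : set T -> X) : Prop :=
  exists fn : nat -> T -> X, defining fn f /\
    exists s : nat -> X,
      (forall n, is_vsup [set vabs (simple_integral A (fn n) - l A)
                          | A in measurable] (s n)) /\
      cv_to L s 0.

(* Integrability and integral of a positive function. The integral does not
   depend on the choice of [l] in [is_pos_integral]. *)
Definition pos_integrable f : Prop :=
  (forall t, 0 <= f t) /\ exists l, is_pos_integral f l.

Definition pos_integral A f : X :=
  xget 0 [set v | exists l, is_pos_integral f l /\ v = l A].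

Definition vintegrable f : Prop :=
  pos_integrable (fun t => vpos (f t)) /\ pos_integrable (fun t => vneg (f t)).

Definition vintegral A f : X :=
  pos_integral A (fun t => vpos (f t)) - pos_integral A (fun t => vneg (f t)).

End vintegral.

Definition vunif_continuous (R : realType) (G : pmetricType R)
    (X : dedekindVLatticeType R) (f : G -> X) : Prop :=
  exists2 u : X, 0 <= u &
    forall e : R, 0 < e -> exists2 dl : R, 0 < dl &
      forall g1 g2 : G, mdist g1 g2 <= dl -> vabs (f g1 - f g2) <= e *: u.

Definition vconvex (R : numDomainType) (X : dedekindVLatticeType R)
    (mul : X -> X -> X) (phi : X -> X) : Prop :=
  exists beta : X -> X,
    (forall v s, phi v + mul (beta v) (s - v) <= phi s) /\
    (forall u, 0 <= u -> u != 0 ->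
      order_bounded [set beta v | v in [set v | - u <= v <= u]]).

(* Main.v *)
(* Cut [C] into finitely many Borel pieces on which both [f] and [h] vary by
   at most [1/n], and replace [h f] by the step function with values
   [a_p f(g_p)], where [a_p] is a lower bound of [h] on the piece [p]. These step
   functions approximate [h f] uniformly, up to [1/n] times a fixed element,
   and live on a set of finite measure, so they are a defining sequence; any
   other defining sequence has the same limit. A convex map is Lipschitz on
   order intervals, so the same pieces serve for [h phi(f)]. With
   [c_p = a_p mu(p)] the total weight is at most [int h = 1], and for the tangent
   of slope [b] at [v = int h f] one gets
   [sum c_p phi(f(g_p)) >= phi(v) + b (sum c_p f(g_p) - v)];
   the missing mass is harmless because [phi(0) = 0]. Let [n] go to infinity. *)

Require Import Defs.
From mathcomp Require Import all_boot all_order all_algebra.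
From mathcomp Require Import all_classical all_reals all_analysis.
From mathcomp Require Import measurable_realfun.

Set Implicit Arguments.
Unset Strict Implicit.
Unset Printing Implicit Defensive.

Import Order.TTheory GRing.Theory Num.Theory.
Import numFieldNormedType.Exports.

Local Open Scope classical_set_scope.
Local Open Scope ring_scope.

(** * Vector lattices *)

Section vlattice.
Context {R : realType} {X : dedekindVLatticeType R}.
Implicit Types (x y z t u v w : X) (a b : R).

Lemma vleD2rE x y z : (x + z <= y + z) = (x <= y).
Proof.
apply/idP/idP => [h|]; last exact: vleD2r.
by have := @vleD2r R X _ _ (- z) h; rewrite !addrK.
Qed.

Lemma vleD2lE x y z : (z + x <= z + y) = (x <= y).
Proof. by rewrite ![z + _]addrC vleD2rE. Qed.

Lemma vleD x y z t : x <= y -> z <= t -> x + z <= y + t.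
Proof. by move=> xy zt; apply: (@le_trans _ _ (y + z)); rewrite ?vleD2rE ?vleD2lE. Qed.

Lemma vleBrD x y z : (x <= y - z) = (x + z <= y).
Proof. by rewrite -(vleD2rE x (y - z) z) subrK. Qed.

Lemma vleBlD x y z : (x - y <= z) = (x <= z + y).
Proof. by rewrite -(vleD2rE (x - y) z y) subrK. Qed.

Lemma vsub_ge0 x y : (0 <= y - x) = (x <= y).
Proof. by rewrite vleBrD add0r. Qed.

Lemma vleN2 x y : (- x <= - y) = (y <= x).
Proof. by rewrite -(vsub_ge0 (- x)) opprK addrC vsub_ge0. Qed.

Lemma vaddr_ge0 x y : 0 <= x -> 0 <= y -> 0 <= x + y.
Proof. by move=> x0 y0; rewrite -(addr0 0); exact: vleD. Qed.

Lemma vsum_ge0 (I : Type) (r : seq I) (P : pred I) (F : I -> X) :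
  (forall i, P i -> 0 <= F i) -> 0 <= \sum_(i <- r | P i) F i.
Proof. by move=> F0; elim/big_rec: _ => // i x /F0; exact: vaddr_ge0. Qed.

Lemma vle_sum (I : Type) (r : seq I) (P : pred I) (F H : I -> X) :
  (forall i, P i -> F i <= H i) ->
  \sum_(i <- r | P i) F i <= \sum_(i <- r | P i) H i.
Proof. by move=> FH; elim/big_rec2: _ => // i x y /FH; exact: vleD. Qed.

Lemma vscale_le a x y : 0 <= a -> x <= y -> a *: x <= a *: y.
Proof. by move=> a0 xy; rewrite -vsub_ge0 -scalerBr vscale_ge0// vsub_ge0. Qed.

Lemma vscale_ler a b x : 0 <= x -> a <= b -> a *: x <= b *: x.
Proof. by move=> x0 ab; rewrite -vsub_ge0 -scalerBl vscale_ge0// subr_ge0. Qed.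

Lemma vscale_le2 a b x y : 0 <= a -> a <= b -> 0 <= y -> x <= y ->
  a *: x <= b *: y.
Proof.
by move=> a0 ab y0 xy; apply: le_trans (vscale_le a0 xy) _; exact: vscale_ler.
Qed.

Lemma vle_joinl1 x y : x <= vjoin x y.
Proof. by have := lexx (vjoin x y); rewrite vle_joinl => /andP[]. Qed.

Lemma vle_joinl2 x y : y <= vjoin x y.
Proof. by have := lexx (vjoin x y); rewrite vle_joinl => /andP[]. Qed.

Lemma vabs_le x y : (vabs x <= y) = (x <= y) && (- x <= y).
Proof. exact: vle_joinl. Qed.

Lemma vle_abs x : x <= vabs x. Proof. exact: vle_joinl1. Qed.

Lemma vle_absN x : - x <= vabs x. Proof. exact: vle_joinl2. Qed.

(** Multiplication by 1/2 preserves positivity. Adding [x <= |x|] and [- x <= |x|] then yields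
    [|x| >= 0]. *)
Lemma vdouble_ge0 x : 0 <= x + x -> 0 <= x.
Proof.
move=> xx0; have : 0 <= 2^-1 *: (x + x) by rewrite vscale_ge0 ?invr_ge0.
by rewrite -(mulr2n x) -(scaler_nat 2 x) scalerA mulVf ?scale1r.
Qed.

Lemma vabs_ge0 x : 0 <= vabs x.
Proof. by rewrite vdouble_ge0// -(subrr x) vleD ?vle_abs ?vle_absN. Qed.

Lemma vabsN x : vabs (- x) = vabs x.
Proof.
have le y : vabs (- y) <= vabs y by rewrite vabs_le opprK vle_absN vle_abs.
by apply/le_anti; rewrite le -{1}(opprK x) le.
Qed.

Lemma vabs_distC x y : vabs (x - y) = vabs (y - x).
Proof. by rewrite -vabsN opprB. Qed.

Lemma vabsD x y : vabs (x + y) <= vabs x + vabs y.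
Proof. by rewrite vabs_le opprD !vleD ?vle_abs ?vle_absN. Qed.

Lemma vabs_dist x y z : vabs (x - z) <= vabs (x - y) + vabs (y - z).
Proof. by rewrite -{1}(subrKA y) vabsD. Qed.

Lemma vabs_pos x : 0 <= x -> vabs x = x.
Proof.
move=> x0; apply/le_anti; rewrite vle_abs andbT vabs_le lexx/=.
by rewrite (le_trans _ x0)// -{1}oppr0 vleN2.
Qed.

Lemma vabs0 : vabs (0 : X) = 0.
Proof. exact: vabs_pos. Qed.

Lemma vabs_le0 x : vabs x <= 0 -> x = 0.
Proof.
rewrite vabs_le => /andP[x0 Nx0]; apply/le_anti; rewrite x0/=.
by rewrite -vleN2 oppr0.
Qed.

Lemma vabs_scale_le a x : 0 <= a -> vabs (a *: x) <= a *: vabs x.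
Proof. by move=> a0; rewrite vabs_le -scalerN !vscale_le ?vle_abs ?vle_absN. Qed.

Lemma vpos_le x y : (vpos x <= y) = (x <= y) && (0 <= y).
Proof. exact: vle_joinl. Qed.

Lemma vle_pos x : x <= vpos x. Proof. exact: vle_joinl1. Qed.

Lemma vpos_ge0 x : 0 <= vpos x. Proof. exact: vle_joinl2. Qed.

Lemma vposB_le x y : vpos x <= vpos y + vabs (x - y).
Proof.
rewrite vpos_le vaddr_ge0 ?vpos_ge0 ?vabs_ge0// andbT.
by rewrite -{1}(subrK y x) addrC vleD ?vle_pos ?vle_abs.
Qed.

(** Transfers uniform estimates from a function to its positive part, through which the integral is
    defined. *)
Lemma vpos_lip x y : vabs (vpos x - vpos y) <= vabs (x - y).
Proof.
rewrite vabs_le opprB !vleBlD ![vabs _ + _]addrC vposB_le.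
by rewrite vabs_distC vposB_le.
Qed.

Lemma vpos_abs x : vpos x <= vabs x.
Proof. by rewrite vpos_le vle_abs vabs_ge0. Qed.

Lemma vpos0 : vpos (0 : X) = 0.
Proof. by apply/le_anti; rewrite vpos_ge0 vpos_le lexx. Qed.

Lemma vposZ_le a x : 0 <= a -> vpos (a *: x) <= a *: vpos x.
Proof.
by move=> a0; rewrite vpos_le vscale_le ?vle_pos// vscale_ge0 ?vpos_ge0.
Qed.

Lemma vposZ a x : 0 <= a -> vpos (a *: x) = a *: vpos x.
Proof.
move=> a0; apply/le_anti; rewrite vposZ_le//=.
have [->|an0] := eqVneq a 0; first by rewrite !scale0r vpos0.
(* The reverse inequality is [vposZ_le] with factor [a^-1], applied to [a *: x]. *)
rewrite -[X in vpos X](scale1r x) -(mulVf an0) -scalerA.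
apply: le_trans (vscale_le a0 (vposZ_le _ _)) _; first by rewrite invr_ge0.
by rewrite scalerA mulfV// scale1r.
Qed.

Lemma vnegE x : vneg x = vpos (- x). Proof. by []. Qed.

Lemma vpos_neg x : vpos x - vneg x = x.
Proof.
(* One inequality suffices: at [x] it gives one half of the equality, at [- x] the other. *)
suff posE y : vpos y <= y + vneg y.
  apply/le_anti; rewrite vleBlD posE/= vleBrD addrC -vleBrD vnegE.
  by rewrite -[X in _ <= X]addrC; have := posE (- x); rewrite vnegE opprK addrC.
rewrite vpos_le vnegE -{1}[y]addr0 vleD2lE vpos_ge0/=.
by rewrite -{1}(subrr y) vleD2lE vle_pos.
Qed.

(** Dedekind completeness supplies the suprema required by convergence in measure and by the
    definition of the integral. The condition [0 <= u] covers the empty family, whose supremum is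
    0. *)
Lemma vlub_le (E : set X) u : (forall x, E x -> 0 <= x <= u) -> 0 <= u ->
  exists s, is_vsup E s /\ 0 <= s <= u.
Proof.
move=> Eu u0; have [->|E0] := pselect (E = set0).
  by exists 0; split; [left|rewrite lexx].
have {}E0 : E !=set0 by apply/set0P/eqP.
have ubE : ubound E u by move=> x /Eu/andP[].
have [s [sub smin]] := @vdedekind R X E E0 (ex_intro _ u ubE).
exists s; split; first by right.
rewrite smin// andbT; case: E0 => x Ex.
by have /andP[x0 _] := Eu _ Ex; rewrite (le_trans x0)// sub.
Qed.

Lemma is_vsup_ub (E : set X) s x : is_vsup E s -> E x -> x <= s.
Proof. by case=> [[-> _]//|[_ [sub _]] Ex]; exact: sub. Qed.

Lemma is_vsup_ge0 (E : set X) s : is_vsup E s -> (forall x, E x -> 0 <= x) ->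
  0 <= s.
Proof.
by case=> [[_ ->]//|[[x Ex] [sub _]]] E0; rewrite (le_trans (E0 _ Ex))// sub.
Qed.

End vlattice.

(** * Convergences and products *)

Section convergence_theory.
Context {R : realType} {X : dedekindVLatticeType R} (L : convergence X).
Implicit Types (x y e : nat -> X) (a b c u w : X).

Lemma cv_to_cst c : cv_to L (fun=> c) c.
Proof. by apply: (cv_cst L); near=> n. Unshelve. all: by end_near. Qed.

Lemma cv_to_eq x y a : x =1 y -> cv_to L x a -> cv_to L y a.
Proof. by move=> /funext ->. Qed.

Lemma cv_to_linear (k : R) x y a b : cv_to L x a -> cv_to L y b ->
  cv_to L (fun n => k *: x n + y n) (k *: a + b).
Proof.
by move=> [xd <-] [yd <-]; exact: (cv_linear k xd yd).
Qed.

Lemma cv_toD x y a b : cv_to L x a -> cv_to L y b ->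
  cv_to L (fun n => x n + y n) (a + b).
Proof.
move=> xa yb; have := cv_to_linear 1 xa yb; rewrite scale1r.
by apply: cv_to_eq => n; rewrite scale1r.
Qed.

Lemma cv_toZ (k : R) x a : cv_to L x a -> cv_to L (fun n => k *: x n) (k *: a).
Proof.
move=> xa; have := cv_to_linear k xa (cv_to_cst 0); rewrite addr0.
by apply: cv_to_eq => n; rewrite addr0.
Qed.

Lemma cv_toB x y a b : cv_to L x a -> cv_to L y b ->
  cv_to L (fun n => x n - y n) (a - b).
Proof.
move=> xa /(cv_toZ (-1)); rewrite scaleN1r => /(cv_toD xa).
by apply: cv_to_eq => n; rewrite scaleN1r.
Qed.

Lemma cv_to_le x y a b : cv_to L x a -> cv_to L y b ->
  (forall n, x n <= y n) -> a <= b.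
Proof.
move=> [xd <-] [yd <-] xy; apply: (cv_mono xd yd).
by near=> n; exact: xy.
Unshelve. all: by end_near. Qed.

(** The squeeze axiom only places [y] in the domain; its limit is then found from monotonicity on
    both sides. *)
Lemma cv_to_squeeze x y z a : cv_to L x a -> cv_to L z a ->
  (forall n, x n <= y n <= z n) -> cv_to L y a.
Proof.
move=> xa za xyz; have [xd xlim] := xa; have [zd zlim] := za.
have yd : cv_dom L y.
  apply: (cv_squeeze xd zd); first by rewrite xlim zlim.
  by near=> n; exact: xyz.
have ya : cv_to L y (cv_lim L y) by [].
suff <- : cv_lim L y = a by [].
by apply/le_anti; rewrite (cv_to_le ya za) ?(cv_to_le xa ya)// => n;
  have /andP[] := xyz n.
Unshelve. all: by end_near. Qed.

Lemma cv_to0_squeeze e x : cv_to L e 0 -> (forall n, 0 <= x n <= e n) ->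
  cv_to L x 0.
Proof. by move=> e0; apply: cv_to_squeeze (cv_to_cst 0) e0. Qed.

Lemma cv_to_dist e x a : cv_to L e 0 -> (forall n, vabs (x n - a) <= e n) ->
  cv_to L x a.
Proof.
move=> e0 xae; have aBe := cv_toB (cv_to_cst a) e0.
have aDe := cv_toD (cv_to_cst a) e0; rewrite subr0 in aBe; rewrite addr0 in aDe.
apply: (cv_to_squeeze aBe aDe) => n; have := xae n.
rewrite vabs_le opprB => /andP[h1 h2].
apply/andP; split; first by rewrite vleBlD addrC -vleBlD.
by rewrite addrC -vleBlD.
Qed.

Lemma cv_to_harmonic u : 0 <= u -> cv_to L (fun n => n.+1%:R^-1 *: u) 0.
Proof. exact: (cv_harmonic L). Qed.

Lemma cv_to_limsup x : (forall n, 0 <= x n) -> cv_to L x 0 ->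
  cv_limsup L x = Fin 0.
Proof. by move=> x0 [xd xl]; rewrite (cv_limsup_dom x0 xd) xl. Qed.

(** By subadditivity of the limit superior, an error [e] tending to 0 adds nothing to the limit
    superior of [x], and that of the constant [c] is [c]. *)
Lemma le_limsup c x e s : 0 <= c -> (forall n, 0 <= x n) ->
  (forall n, 0 <= e n) -> cv_limsup L x = Fin s -> cv_to L e 0 ->
  (forall n, c <= x n + e n) -> c <= s.
Proof.
move=> c0 x0 e0 xs /(cv_to_limsup e0) es cxe.
have cc : cv_limsup L (fun=> c) = Fin c.
  have [cd cl] := cv_to_cst c.
  by rewrite (cv_limsup_dom (x := fun=> c)) ?cl.
have le1 : upper_le (Fin c) (cv_limsup L (fun n => x n + e n)).
  rewrite -cc; apply: (cv_limsup_mono L) => // [n|].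
    by rewrite vaddr_ge0.
  by near=> n; exact: cxe.
have := cv_limsupD L x0 e0; rewrite xs es /= addr0.
by move: le1; case: (cv_limsup L _) => //= y /le_trans; exact.
Unshelve. all: by end_near. Qed.

(** The archimedean property of the lattice, obtained from the convergence of [u / (n+1)] to 0. *)
Lemma le_harmonic0 a u : 0 <= u -> (forall n : nat, a <= n.+1%:R^-1 *: u) ->
  a <= 0.
Proof. by move=> u0; apply: cv_to_le (cv_to_cst a) (cv_to_harmonic u0). Qed.

(** Every lower end [x n - w / (n+1)] lies below every upper end [x m + w / (m+1)], so the supremum
    of the lower ends lies between the two ends for each index. *)
Lemma cauchy_limit x w :
  (forall n m : nat, x n - x m <= n.+1%:R^-1 *: w + m.+1%:R^-1 *: w) ->
  exists l, forall n : nat, vabs (x n - l) <= n.+1%:R^-1 *: w.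
Proof.
move=> xw; pose E := [set x n - n.+1%:R^-1 *: w | n in [set: nat]].
have ubE m : ubound E (x m + m.+1%:R^-1 *: w).
  move=> _ [n _ <-]; rewrite vleBlD -addrA addrC -vleBlD.
  by rewrite [X in _ <= X]addrC.
have E0 : E !=set0 by exists (x 0 - 1%:R^-1 *: w), 0.
have [l [lub lmin]] := @vdedekind R X E E0 (ex_intro _ _ (ubE 0)).
exists l => n; rewrite vabs_le opprB; apply/andP; split.
  by rewrite vleBlD addrC -vleBlD lub//; exists n.
by rewrite vleBlD addrC lmin.
Qed.

End convergence_theory.

(** * Positive additive maps, product algebras and convex maps *)

Section additive_maps.
Context {R : realType} {X : dedekindVLatticeType R} (L : convergence X).
Variable T : X -> X.
Hypothesis TD : forall x y, T (x + y) = T x + T y.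
Implicit Types (x y : X) (a : R).

Lemma additive0 : T 0 = 0.
Proof. by apply: (addrI (T 0)); rewrite -TD !addr0. Qed.

Lemma additiveN x : T (- x) = - T x.
Proof. by apply: (addrI (T x)); rewrite -TD !subrr additive0. Qed.

Lemma additiveMn x n : T (x *+ n) = T x *+ n.
Proof. by elim: n => [|n IH]; rewrite ?additive0// !mulrS TD IH. Qed.

Lemma additiveV x n : T (n.+1%:R^-1 *: x) = n.+1%:R^-1 *: T x.
Proof.
apply: (@scalerI _ _ n.+1%:R); first by rewrite pnatr_eq0.
rewrite scalerA mulfV ?pnatr_eq0// scale1r scaler_nat -additiveMn.
by rewrite -[X in T X]scaler_nat scalerA mulfV ?pnatr_eq0// scale1r.
Qed.

Hypothesis T0 : forall x, 0 <= x -> 0 <= T x.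

Lemma additive_le x y : x <= y -> T x <= T y.
Proof. by rewrite -vsub_ge0 => /T0; rewrite TD additiveN vsub_ge0. Qed.

(* Additivity gives the rational factors and monotonicity squeezes the real
   ones between them. *)
Lemma additive_pos_scale_ge0 a x : 0 <= a -> 0 <= x -> T (a *: x) = a *: T x.
Proof.
move=> a0 x0; apply/subr0_eq/vabs_le0.
apply: (le_harmonic0 L (T0 x0)) => n.
(* Since [k / (n+1) <= a <= (k+1) / (n+1)], both [T (a *: x)] and [a *: T x] lie between consecutive
   multiples of [T x / (n+1)]. *)
pose k := Num.truncn (a * n.+1%:R).
have n0 : 0 < n.+1%:R :> R by rewrite ltr0n.
have an0 : 0 <= a * n.+1%:R by rewrite mulr_ge0.
have ka : n.+1%:R^-1 * k%:R <= a.
  by rewrite ler_pdivrMl// mulrC truncn_le.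
have ak : a <= n.+1%:R^-1 * k.+1%:R.
  by rewrite ler_pdivlMl// mulrC ltW// truncnS_gt.
have Tk j y : T ((n.+1%:R^-1 * j%:R) *: y) = (n.+1%:R^-1 * j%:R) *: T y.
  by rewrite -!scalerA additiveV !scaler_nat additiveMn.
have kS y : (n.+1%:R^-1 * k.+1%:R) *: y = n.+1%:R^-1 *: y + (n.+1%:R^-1 * k%:R) *: y.
  by rewrite -scalerDl -[k.+1%:R]natr1 mulrDr mulr1 addrC.
rewrite vabs_le opprB !vleBlD; apply/andP; split.
- apply: le_trans (additive_le (vscale_ler x0 ak)) _.
  by rewrite Tk kS vleD2lE vscale_ler ?T0.
- apply: le_trans (vscale_ler (T0 x0) ak) _.
  by rewrite kS vleD2lE -Tk additive_le// vscale_ler.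
Qed.

Lemma additive_pos_scale a x : T (a *: x) = a *: T x.
Proof.
have Tpos b y : 0 <= b -> T (b *: y) = b *: T y.
  move=> b0; rewrite -(vpos_neg y) scalerBr !TD !additiveN.
  by rewrite !additive_pos_scale_ge0 ?vpos_ge0// scalerBr.
have [a0|/ltW a0] := leP 0 a; first exact: Tpos.
by rewrite -(opprK a) (scaleNr (- a) x) additiveN Tpos ?oppr_ge0// -scaleNr.
Qed.

End additive_maps.

Section product_algebra_theory.
Context {R : realType} {X : dedekindVLatticeType R} {L : convergence X}.
Context {mul : X -> X -> X} (algX : product_algebra L mul).
Implicit Types (b x y : X) (a : R).

Let mulDl b b' x : mul (b + b') x = mul b x + mul b' x.
Proof. exact: pt_addl algX _ _ _. Qed.

Lemma pmulDr b x y : mul b (x + y) = mul b x + mul b y.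
Proof. exact: pt_addr algX _ _ _. Qed.

Let mulNl b x : mul (- b) x = - mul b x.
Proof. exact: (additiveN (T := mul^~ x)). Qed.

Lemma pmulNr b x : mul b (- x) = - mul b x.
Proof. exact: (additiveN (pmulDr b)). Qed.

Lemma pmul_ge0 b x : 0 <= b -> 0 <= x -> 0 <= mul b x.
Proof.
move=> b0 x0; rewrite -(additive0 (pmulDr b)).
exact: pt_monor algX _ _ _ b0 x0.
Qed.

(** The product is only assumed biadditive. Homogeneity comes from splitting [b] into positive and
    negative parts, each of which acts as a positive additive map. *)
Lemma pmulZr a b x : mul b (a *: x) = a *: mul b x.
Proof.
rewrite -(vpos_neg b) !mulDl !mulNl scalerBr.
by congr (_ - _); apply: (additive_pos_scale L) => [y z|y y0];
  rewrite ?pmulDr// pmul_ge0// vpos_ge0.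
Qed.

Lemma pmul_sum (I : Type) (r : seq I) (P : pred I) (F : I -> X) b :
  mul b (\sum_(i <- r | P i) F i) = \sum_(i <- r | P i) mul b (F i).
Proof. by apply: big_morph; [exact: pmulDr|exact: additive0 (pmulDr b)]. Qed.

Lemma pmul_le_abs B b x : vabs b <= B -> mul b x <= mul B (vabs x).
Proof.
(* [(B - b)(|x| + x) + (B + b)(|x| - x)] is twice [B|x| - b x] *)
rewrite vabs_le => /andP[]; rewrite -(vsub_ge0 b) -(vsub_ge0 (- b)) opprK.
move=> bB NbB; rewrite -vsub_ge0; apply: vdouble_ge0.
have xx : 0 <= vabs x - x by rewrite vsub_ge0 vle_abs.
have xN : 0 <= vabs x + x by rewrite -{2}(opprK x) vsub_ge0 vle_absN.
have := vaddr_ge0 (pmul_ge0 bB xN) (pmul_ge0 NbB xx).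
rewrite !mulDl !pmulDr !mulNl !pmulNr.
set p := mul B _; set q := mul B x; set r := mul b _; set s := mul b x.
rewrite (addrC (- r)) (addrACA p q) (addrC r) (addrACA p (- q)) (addrACA (p - s)).
by rewrite (addrC (- q)) -(opprB q r) subrr addr0.
Qed.

(* The slopes at the two end points bound the increment from both sides. *)
Lemma vconvex_lipschitz (phi : X -> X) : vconvex mul phi ->
  forall u, 0 <= u -> exists2 B, 0 <= B &
    forall s v, vabs s <= u -> vabs v <= u ->
      vabs (phi s - phi v) <= mul B (vabs (s - v)).
Proof.
move=> [beta [slope bnd]] u u0.
(* Convexity bounds the slopes only for [u != 0]; for [u = 0] both points are 0. *)
have [->|un0] := eqVneq u 0.
  exists 0; rewrite ?lexx// => s v /vabs_le0 -> /vabs_le0 ->.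
  by rewrite !subrr vabs0 (additive0 (pmulDr 0)).
have [[lb lbP] [ub ubP]] := bnd u u0 un0.
(* The slopes lie between [lb] and [ub], hence in the symmetric interval of radius [|lb| + |ub|]. *)
have betaB v : vabs v <= u -> vabs (beta v) <= vabs lb + vabs ub.
  rewrite vabs_le => /andP[vu Nvu].
  have Dv : [set beta v | v in [set v | - u <= v <= u]] (beta v).
    by exists v => //=; rewrite vu andbT -vleN2 opprK.
  rewrite vabs_le; apply/andP; split.
    rewrite -(add0r (beta v)) vleD ?vabs_ge0//.
    exact: le_trans (ubP _ Dv) (vle_abs ub).
  rewrite -(addr0 (- beta v)) vleD ?vabs_ge0//.
  by apply: le_trans (vle_absN lb); rewrite vleN2; exact: lbP.
exists (vabs lb + vabs ub); first by rewrite vaddr_ge0 ?vabs_ge0.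
move=> s v su vu.
have half p q : vabs p <= u ->
    phi p - phi q <= mul (vabs lb + vabs ub) (vabs (p - q)).
  move=> pu; apply: le_trans (pmul_le_abs _ (betaB p pu)).
  by rewrite vleBlD addrC -vleBlD -pmulNr opprB; exact: slope.
by rewrite vabs_le opprB half//= vabs_distC half.
Qed.

End product_algebra_theory.

(** * Integrals of simple functions *)

Section simple_integral_theory.
Context {d : measure_display} {T : measurableType d} {R : realType}
  {X : dedekindVLatticeType R} (mu : {content set T -> \bar R}).
Implicit Types (f g : T -> X) (A B C E : set T) (a : R) (x : X).

Lemma content_fin_sub A B : measurable A -> measurable B -> A `<=` B ->
  (mu B < +oo)%E -> (mu A < +oo)%E.
Proof.
by move=> mA mB AB; apply: le_lt_trans; apply: le_measure; rewrite ?inE.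
Qed.

Lemma fine_content_split E B : measurable E -> measurable B ->
  (mu E < +oo)%E ->
  fine (mu E) = fine (mu (E `&` B)) + fine (mu (E `\` B)).
Proof.
move=> mE mB Efin.
have mI : measurable (E `&` B) by exact: measurableI.
have mD : measurable (E `\` B) by exact: measurableD.
rewrite -fineD ?ge0_fin_numE ?measure_ge0//.
- by rewrite -measureU ?setUIDK// -subset0 => t [[_ Bt] [_ /(_ Bt)]].
- by rewrite (content_fin_sub mI mE _ Efin)//; exact: subIsetl.
- by rewrite (content_fin_sub mD mE _ Efin)//; exact: subDsetl.
Qed.

Lemma fine_content_ge0 A : 0 <= fine (mu A).
Proof. by rewrite fine_ge0// measure_ge0. Qed.

Lemma fine_content_le A B : measurable A -> measurable B -> A `<=` B ->
  (mu B < +oo)%E -> fine (mu A) <= fine (mu B).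
Proof.
move=> mA mB AB Bfin; have Afin := content_fin_sub mA mB AB Bfin.
by rewrite fine_le ?ge0_fin_numE ?measure_ge0// le_measure ?inE.
Qed.

Local Notation indR A t := (\1_A t : R).

(* By induction on the number of sets, splitting the domain along the first
   one: no common refinement of the sets is needed. *)
Lemma simple_sum_ge0 r (c : 'I_r -> X) (B : 'I_r -> set T) E x :
  (forall j, measurable (B j)) -> measurable E -> (mu E < +oo)%E ->
  (forall t, E t -> 0 <= x + \sum_j indR (B j) t *: c j) ->
  0 <= fine (mu E) *: x + \sum_j fine (mu (E `&` B j)) *: c j.
Proof.
elim: r c B E x => [|r IH] c B E x mB mE Efin h.
  have [->|/set0P[t Et]] := eqVneq E set0.
    by rewrite measure0 scale0r add0r big_ord0.
  have := h t Et; rewrite !big_ord0 !addr0 => x0.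
  by rewrite vscale_ge0 ?fine_content_ge0.
pose B0 := B ord0; pose B' i := B (lift ord0 i); pose c' i := c (lift ord0 i).
have mB' j : measurable (B' j) by exact: mB.
have mI : measurable (E `&` B0) := measurableI _ _ mE (mB ord0).
have mD : measurable (E `\` B0) := measurableD mE (mB ord0).
have fI := content_fin_sub mI mE (@subIsetl _ _ _) Efin.
have fD := content_fin_sub mD mE (@subDsetl _ _ _) Efin.
(* Inside the first set its coefficient is absorbed into the constant [x]; outside it the
   coefficient disappears. *)
have h1 : 0 <= fine (mu (E `&` B0)) *: (x + c ord0) +
    \sum_j fine (mu (E `&` B0 `&` B' j)) *: c' j.
  apply: (IH c' B' (E `&` B0) (x + c ord0)) => // t [Et B0t]; have := h t Et.
  by rewrite big_ord_recl indicE mem_set//= scale1r addrA.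
have h2 : 0 <= fine (mu (E `\` B0)) *: x +
    \sum_j fine (mu ((E `\` B0) `&` B' j)) *: c' j.
  apply: (IH c' B' (E `\` B0) x) => // t [Et B0t]; have := h t Et.
  by rewrite big_ord_recl indicE memNset//= scale0r add0r.
have split j : fine (mu (E `&` B' j)) =
    fine (mu (E `&` B0 `&` B' j)) + fine (mu ((E `\` B0) `&` B' j)).
  have mEB : measurable (E `&` B' j) by exact: measurableI.
  have fEB := content_fin_sub mEB mE (@subIsetl _ _ _) Efin.
  rewrite (fine_content_split mEB (mB ord0) fEB).
  by congr (fine (mu _) + fine (mu _)); rewrite ?setDE setIAC.
have := vaddr_ge0 h1 h2; rewrite scalerDr addrACA -big_split/=.
under eq_bigr do rewrite -scalerDl -split.
rewrite big_ord_recl (fine_content_split mE (mB ord0) Efin) -/B0 scalerDl.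
by rewrite addrA (addrAC _ (fine _ *: c ord0)).
Qed.

Lemma content_finU A B : measurable A -> measurable B ->
  (mu A < +oo)%E -> (mu B < +oo)%E -> (mu (A `|` B) < +oo)%E.
Proof.
by move=> mA mB Af Bf; apply: le_lt_trans (measureU2 _ mA mB) _; exact: lte_add_pinfty.
Qed.

(** Provides one set of finite measure carrying the whole function, to which [simple_sum_ge0] can be
    applied even when the domain of integration has infinite measure. *)
Lemma simple_repr_support r (c : 'I_r -> X) (B : 'I_r -> set T) f :
  simple_repr mu c B f -> exists U, [/\ measurable U, (mu U < +oo)%E,
    forall j, B j `<=` U & forall t, ~ U t -> f t = 0].
Proof.
move=> [mB fE]; exists (\big[setU/set0]_(j < r) B j).
have BU j : B j `<=` \big[setU/set0]_(j < r) B j.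
  by move=> t Bt; rewrite (bigD1 j)//=; left.
have [mU Uf] : measurable (\big[setU/set0]_(j < r) B j) /\
    (mu (\big[setU/set0]_(j < r) B j) < +oo)%E.
  elim/big_ind: _ => [|C D [mC Cf] [mD Df]|j _]; last exact: mB.
    by rewrite measure0; split => //; exact: measurable0.
  by split; [exact: measurableU|exact: content_finU].
split=> // t Ut; rewrite fE big1// => j _.
by rewrite indicE memNset ?scale0r// => /BU.
Qed.

Lemma simple_repr_ge0 r (c : 'I_r -> X) (B : 'I_r -> set T) f A :
  simple_repr mu c B f -> measurable A -> (forall t, A t -> 0 <= f t) ->
  0 <= \sum_j fine (mu (A `&` B j)) *: c j.
Proof.
move=> fr mA f0; have [U [mU Uf BU _]] := simple_repr_support fr.
have [mB fE] := fr.
have mAU : measurable (A `&` U) by exact: measurableI.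
have AUf := content_fin_sub mAU mU (@subIsetr _ _ _) Uf.
have := @simple_sum_ge0 r c B (A `&` U) 0 (fun j => (mB j).1) mAU AUf.
rewrite scaler0 add0r.
under eq_bigr => j _ do rewrite -setIA (setIidr (BU j)).
by apply=> t [At _]; rewrite add0r -fE f0.
Qed.

Lemma simple_repr_linear a r1 r2 (c1 : 'I_r1 -> X) (c2 : 'I_r2 -> X)
    (B1 : 'I_r1 -> set T) (B2 : 'I_r2 -> set T) f g :
  simple_repr mu c1 B1 f -> simple_repr mu c2 B2 g ->
  exists (c : 'I_(r1 + r2) -> X) (B : 'I_(r1 + r2) -> set T),
    simple_repr mu c B (fun t => a *: f t + g t) /\
    forall A, \sum_j fine (mu (A `&` B j)) *: c j =
      a *: (\sum_j fine (mu (A `&` B1 j)) *: c1 j) +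
      \sum_j fine (mu (A `&` B2 j)) *: c2 j.
Proof.
move=> [mB1 fE] [mB2 gE].
pose c (i : 'I_(r1 + r2)) := match fintype.split i with inl j => a *: c1 j | inr j => c2 j end.
pose B (i : 'I_(r1 + r2)) := match fintype.split i with inl j => B1 j | inr j => B2 j end.
(* Proved for an arbitrary weight [w] on sets: the indicator at a point gives the values of the
   function, the measure of the intersection with [A] gives the integral. *)
have sum (w : set T -> R) : \sum_j w (B j) *: c j =
    a *: (\sum_j w (B1 j) *: c1 j) + \sum_j w (B2 j) *: c2 j.
  rewrite big_split_ord/= scaler_sumr; congr (_ + _); apply: eq_bigr => j _.
    rewrite /B /c -[lshift _ _]/(unsplit (inl j)) unsplitK !scalerA.
    by rewrite mulrC.
  by rewrite /B /c -[rshift _ _]/(unsplit (inr j)) unsplitK.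
exists c, B; split=> [|A]; last exact: (sum (fun B => fine (mu (A `&` B)))).
split=> [i|t]; first by rewrite /B; case: fintype.split => j.
by rewrite (sum (fun B => indR B t)) -fE -gE.
Qed.

Lemma simple_repr_le r1 r2 (c1 : 'I_r1 -> X) (c2 : 'I_r2 -> X)
    (B1 : 'I_r1 -> set T) (B2 : 'I_r2 -> set T) f g A :
  simple_repr mu c1 B1 f -> simple_repr mu c2 B2 g -> measurable A ->
  (forall t, A t -> f t <= g t) ->
  \sum_j fine (mu (A `&` B1 j)) *: c1 j <= \sum_j fine (mu (A `&` B2 j)) *: c2 j.
Proof.
move=> f1 g2 mA fg; have [c [B [r12 cE]]] := simple_repr_linear (-1) f1 g2.
have := simple_repr_ge0 r12 mA; rewrite cE scaleN1r addrC vsub_ge0; apply.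
by move=> t At; rewrite scaleN1r addrC vsub_ge0 fg.
Qed.

Local Notation simple := (simple mu).
Local Notation sint := (simple_integral mu).

(** Independence of the representation: [simple_repr_le] compares two representations of the same
    function in both directions. *)
Lemma simple_integralE r (c : 'I_r -> X) (B : 'I_r -> set T) f A :
  simple_repr mu c B f -> measurable A ->
  sint A f = \sum_j fine (mu (A `&` B j)) *: c j.
Proof.
move=> fr mA; apply: xget_subset1; first by exists r, c, B.
move=> _ _ [r1 [c1 [B1 [f1 ->]]]] [r2 [c2 [B2 [f2 ->]]]].
by apply/le_anti; rewrite !(simple_repr_le _ _ mA (f := f) (g := f)).
Qed.

Lemma simple_linear a f g : simple f -> simple g ->
  simple (fun t => a *: f t + g t) /\
  forall A, measurable A ->
    sint A (fun t => a *: f t + g t) = a *: sint A f + sint A g.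
Proof.
move=> [r1 [c1 [B1 f1]]] [r2 [c2 [B2 g2]]].
have [c [B [fg fgE]]] := simple_repr_linear a f1 g2.
split=> [|A mA]; first by exists (r1 + r2)%N, c, B.
by rewrite (simple_integralE fg)// (simple_integralE f1)// (simple_integralE g2).
Qed.

Lemma simpleD f g : simple f -> simple g -> simple (fun t => f t + g t).
Proof.
move=> sf sg; have [+ _] := simple_linear 1 sf sg.
by under [X in simple X]funext do rewrite scale1r.
Qed.

Lemma simple_integralD f g A : simple f -> simple g -> measurable A ->
  sint A (fun t => f t + g t) = sint A f + sint A g.
Proof.
move=> sf sg mA; have [_ /(_ A mA)] := simple_linear 1 sf sg.
by under [X in sint A X]funext do rewrite scale1r; rewrite scale1r.
Qed.

Lemma simpleB f g : simple f -> simple g -> simple (fun t => f t - g t).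
Proof.
move=> sf sg; have [+ _] := simple_linear (-1) sg sf.
by under [X in simple X]funext do rewrite scaleN1r addrC.
Qed.

Lemma simple_integralB f g A : simple f -> simple g -> measurable A ->
  sint A (fun t => f t - g t) = sint A f - sint A g.
Proof.
move=> sf sg mA; have [_ /(_ A mA)] := simple_linear (-1) sg sf.
by under [X in sint A X]funext do rewrite scaleN1r addrC;
  rewrite scaleN1r addrC.
Qed.

Lemma simple_integral_le f g A : simple f -> simple g -> measurable A ->
  (forall t, A t -> f t <= g t) -> sint A f <= sint A g.
Proof.
move=> [r1 [c1 [B1 f1]]] [r2 [c2 [B2 g2]]] mA fg.
by rewrite (simple_integralE f1)// (simple_integralE g2)//; exact: simple_repr_le fg.
Qed.

Lemma simple_repr_indic B x : measurable B -> (mu B < +oo)%E ->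
  simple_repr mu (fun=> x : X) (fun _ : 'I_1 => B) (fun t => indR B t *: x).
Proof. by move=> mB Bf; split=> // t; rewrite big_ord1. Qed.

Lemma simple_indic B x : measurable B -> (mu B < +oo)%E ->
  simple (fun t => indR B t *: x).
Proof. by move=> mB Bf; exists 1, (fun=> x), (fun=> B); exact: simple_repr_indic. Qed.

Lemma simple_integral_indic B x A : measurable B -> (mu B < +oo)%E ->
  measurable A -> sint A (fun t => indR B t *: x) = fine (mu (A `&` B)) *: x.
Proof.
by move=> mB Bf mA; rewrite (simple_integralE (simple_repr_indic x mB Bf))// big_ord1.
Qed.

Lemma simple0 : simple (fun=> 0 : X).
Proof.
exists 0%N, (fun=> 0), (fun=> set0); split=> [[]//|t].
by rewrite big_ord0.
Qed.

Lemma simple_integral0 A : measurable A -> sint A (fun=> 0 : X) = 0.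
Proof.
move=> mA; have := simple_integralB simple0 simple0 mA.
by rewrite [RHS]subrr; under [X in sint A X]funext do rewrite subr0.
Qed.

Lemma simple_integral_ge0 f A : simple f -> measurable A ->
  (forall t, A t -> 0 <= f t) -> 0 <= sint A f.
Proof.
by move=> sf mA f0; rewrite -(simple_integral0 mA) simple_integral_le//; exact: simple0.
Qed.

Lemma simple_integral_eq0 f A : simple f -> measurable A ->
  (forall t, A t -> f t = 0) -> sint A f = 0.
Proof.
move=> sf mA f0; rewrite -(simple_integral0 mA).
by apply/le_anti; rewrite !simple_integral_le//; try exact: simple0;
  move=> t /f0 ->.
Qed.

Lemma simple_integral_split f A E : simple f -> measurable A -> measurable E ->
  sint A f = sint (A `&` E) f + sint (A `\` E) f.
Proof.
move=> [r [c [B fr]]] mA mE; have mI : measurable (A `&` E) by exact: measurableI.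
have mD : measurable (A `\` E) by exact: measurableD.
rewrite !(simple_integralE fr)// -big_split/=; apply: eq_bigr => j _.
have [mB Bf] := fr.1 j; have mAB : measurable (A `&` B j) by exact: measurableI.
have ABf := content_fin_sub mAB mB (@subIsetr _ _ _) Bf.
rewrite -scalerDl (fine_content_split mAB mE ABf).
by congr ((fine (mu _) + fine (mu _)) *: _); rewrite ?setDE setIAC.
Qed.

(** On each piece cut out by the sets of a representation [f] is constant, hence so is [F \o f];
    [F 0 = 0] keeps the support of finite measure. The case in use is [F = vabs]. *)
Lemma simple_comp f (F : X -> X) : F 0 = 0 -> simple f -> simple (F \o f).
Proof.
move=> F0 [r [c [B fr]]]; have [U [mU Uf _ f0]] := simple_repr_support fr.
have [mB fE] := fr; have {}mB j := (mB j).1.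
(* [E] is the current piece and [x] the sum of the coefficients already absorbed, as in
   [simple_sum_ge0]. *)
suff gen r' (c' : 'I_r' -> X) (B' : 'I_r' -> set T) E x :
    (forall j, measurable (B' j)) -> measurable E -> (mu E < +oo)%E ->
    simple (fun t => indR E t *: F (x + \sum_j indR (B' j) t *: c' j)).
  have := gen r c B U 0 mB mU Uf; congr Defs.simple; apply/funext => t /=.
  rewrite add0r -fE; have [Ut|/f0 ft] := pselect (U t).
    by rewrite indicE mem_set// scale1r.
  by rewrite ft F0 scaler0.
elim: r' c' B' E x => [|n IH] c' B' E x mB' mE Ef.
  have := simple_indic (F x) mE Ef; congr Defs.simple; apply/funext => t /=.
  by rewrite big_ord0 addr0.
have mI : measurable (E `&` B' ord0) := measurableI _ _ mE (mB' ord0).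
have mD : measurable (E `\` B' ord0) := measurableD mE (mB' ord0).
have fI := content_fin_sub mI mE (@subIsetl _ _ _) Ef.
have fD := content_fin_sub mD mE (@subDsetl _ _ _) Ef.
have mB'' j : measurable (B' (lift ord0 j)) by [].
have := simpleD (IH (fun j => c' (lift ord0 j)) _ _ (x + c' ord0) mB'' mI fI)
  (IH (fun j => c' (lift ord0 j)) _ _ x mB'' mD fD).
congr Defs.simple; apply/funext => t; rewrite big_ord_recl/= !indicE.
rewrite in_setI in_setD; case: (t \in E); last by rewrite !scale0r addr0.
by case: (t \in B' ord0); rewrite ?scale1r ?scale0r ?add0r ?addr0 ?addrA.
Qed.

Lemma simple_abs f : simple f -> simple (fun t => vabs (f t)).
Proof. exact: (simple_comp (vabs0 (X := X))). Qed.

Lemma simple_integral_abs f A : simple f -> measurable A ->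
  vabs (sint A f) <= sint A (fun t => vabs (f t)).
Proof.
move=> sf mA; have sa := simple_abs sf.
rewrite vabs_le simple_integral_le/= => [|||//|t _]; rewrite ?vle_abs//.
rewrite -vsub_ge0 opprK -simple_integralD// simple_integral_ge0 => [||//|t _] //.
  exact: simpleD.
by rewrite -vsub_ge0 subr0 -{2}(opprK (f t)) vsub_ge0 vle_absN.
Qed.

Lemma simple_integral_bound f A E x : simple f -> measurable A -> measurable E ->
  (mu E < +oo)%E -> (forall t, A t -> E t -> f t <= x) ->
  (forall t, A t -> ~ E t -> f t <= 0) -> sint A f <= fine (mu (A `&` E)) *: x.
Proof.
move=> sf mA mE Ef fx f0; rewrite -simple_integral_indic//.
apply: simple_integral_le => //; first exact: simple_indic.
move=> t At; rewrite indicE; have [Et|Et] := pselect (E t).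
  by rewrite mem_set// scale1r fx.
by rewrite memNset// scale0r f0.
Qed.

End simple_integral_theory.

(** * Uniform approximation by simple functions *)

Section uniform_approximation.
Context {d : measure_display} {T : measurableType d} {R : realType}
  {X : dedekindVLatticeType R}
  (L : convergence X) (LR : convergence (R^o : dedekindVLatticeType R))
  (tripleRXX : product_triple LR L L (fun (r : R^o) (x : X) => (r : R) *: x))
  (mu : {content set T -> \bar R}).
Local Notation simple := (simple mu).
Local Notation sint := (simple_integral mu).

Lemma simple_integral_subset (f : T -> X) (A B : set T) : simple f ->
  measurable A -> measurable B -> A `<=` B -> (forall t, B t -> 0 <= f t) ->
  sint A f <= sint B f.
Proof.
move=> sf mA mB AB f0; rewrite (simple_integral_split sf mB mA) setIidr//.
rewrite -{1}(addr0 (sint A f)) vleD// simple_integral_ge0//.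
  exact: measurableD.
by move=> t [Bt _]; exact: f0.
Qed.

Variables (C : set T) (fn : nat -> T -> X) (f : T -> X) (w : X).
Hypotheses (mC : measurable C) (Cfin : (mu C < +oo)%E) (w0 : 0 <= w).
Hypotheses (fn_simple : forall n, simple (fn n))
  (fn_supp : forall n t, ~ C t -> fn n t = 0)
  (fn_bound : forall n t, vabs (fn n t) <= w)
  (fn_cvg : forall n t, vabs (fn n t - f t) <= n.+1%:R^-1 *: w).

(** Uniform convergence needs no exceptional sets. The integrals are equiabsolutely continuous
    because [|fn n| <= w], and because the constant sequence of sets [C] leaves nothing outside. *)
Lemma uniform_defining : defining L LR mu fn f.
Proof.
split=> // [A mA Afin|].
  exists (fun=> set0); split=> [n||]; first exact: measurable0.
    split=> [n|]; first by rewrite setI0 measure0.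
    by under [X in cv_to _ X]funext do rewrite setI0 measure0; exact: cv_to_cst.
  have wn0 (n : nat) : 0 <= n.+1%:R^-1 *: w by rewrite vscale_ge0// invr_ge0.
  have /choice[s sP] : forall n : nat, exists s,
      is_vsup [set vabs (fn n t - f t) | t in A `\` set0] s /\
      0 <= s <= n.+1%:R^-1 *: w.
    by move=> n; apply: vlub_le => // _ [t _ <-]; rewrite vabs_ge0 fn_cvg.
  exists s; split=> [n|]; first by case: (sP n).
  by apply: (cv_to0_squeeze (cv_to_harmonic L w0)) => n; case: (sP n).
split=> [A mA [Afin A0]|].
  (* The bound [mu (A n) *: w] tends to 0 by the product triple of the reals with [X]. *)
  apply: (cv_to0_squeeze (e := fun n => fine (mu (A n)) *: w)) => [|n].
    exact: (pt_cvl tripleRXX).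
  have sa := simple_abs (fn_simple n).
  rewrite simple_integral_ge0//= => [|t _]; last exact: vabs_ge0.
  apply: le_trans (simple_integral_bound (x := w) sa (mA n) mC Cfin _ _) _ => //.
    by move=> t _ Ct; rewrite fn_supp// vabs0.
  apply: vscale_ler => //; apply: fine_content_le => //.
    exact: measurableI.
  by rewrite -ge0_fin_numE ?measure_ge0.
exists (fun=> C); split=> [//|m n _ //|].
exists (fun=> 0); split=> [m|]; last exact: cv_to_cst.
apply: cv_to_limsup => [n|].
  apply: simple_integral_ge0 => [||t _]; [exact: simple_abs|exact: measurableC|].
  exact: vabs_ge0.
apply: (cv_to_eq _ (cv_to_cst L 0)) => n.
rewrite simple_integral_eq0//; [exact: simple_abs|exact: measurableC|].
by move=> t Ct; rewrite fn_supp// vabs0.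
Qed.

(** On [C] the functions [fn n] and [fn m] differ by at most [w / (n+1) + w / (m+1)], so the
    integrals satisfy [cauchy_limit]. The rate does not depend on [A], which later bounds the
    supremum over all measurable sets. *)
Lemma uniform_integral_limit : exists l : set T -> X,
  forall A, measurable A -> forall n : nat,
    vabs (sint A (fn n) - l A) <= n.+1%:R^-1 *: (fine (mu C) *: w).
Proof.
suff /choice[l lP] : forall A, exists l, measurable A -> forall n : nat,
    vabs (sint A (fn n) - l) <= n.+1%:R^-1 *: (fine (mu C) *: w).
  by exists l.
(* A nonmeasurable set receives the default value 0. *)
move=> A; have [mA|] := pselect (measurable A); last by move=> nA; exists 0.
suff [l lP] : exists l, forall n : nat,
    vabs (sint A (fn n) - l) <= n.+1%:R^-1 *: (fine (mu C) *: w) by exists l.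
apply: cauchy_limit => n m; rewrite -simple_integralB//.
have wnm : 0 <= n.+1%:R^-1 *: w + m.+1%:R^-1 *: w.
  by rewrite vaddr_ge0// vscale_ge0// invr_ge0.
have mAC : measurable (A `&` C) by exact: measurableI.
apply: le_trans (simple_integral_bound
  (x := n.+1%:R^-1 *: w + m.+1%:R^-1 *: w) _ mA mC Cfin _ _) _ => //.
- exact: simpleB.
- move=> t _ _; apply: le_trans (vle_abs _) _.
  apply: le_trans (vabs_dist _ (f t) _) _.
  by rewrite vleD// vabs_distC.
- by move=> t _ Ct; rewrite !fn_supp// subrr.
apply: (@le_trans _ _ (fine (mu C) *: (n.+1%:R^-1 *: w + m.+1%:R^-1 *: w))).
  by rewrite vscale_ler// fine_content_le//; exact: subIsetr.
by rewrite scalerDr !scalerA ![_^-1 * _]mulrC.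
Qed.

Variable l : set T -> X.
Hypothesis lP : forall A, measurable A -> forall n : nat,
  vabs (sint A (fn n) - l A) <= n.+1%:R^-1 *: (fine (mu C) *: w).

Let mw0 : 0 <= fine (mu C) *: w.
Proof. by rewrite vscale_ge0// fine_content_ge0. Qed.

Lemma uniform_is_pos_integral : is_pos_integral L LR mu f l.
Proof.
exists fn; split; first exact: uniform_defining.
have /choice[s sP] : forall n : nat, exists s,
    is_vsup [set vabs (sint A (fn n) - l A) | A in measurable] s /\
    0 <= s <= n.+1%:R^-1 *: (fine (mu C) *: w).
  move=> n; apply: vlub_le => [_ [A mA <-]|]; first by rewrite vabs_ge0 lP.
  by rewrite vscale_ge0// invr_ge0.
exists s; split=> [n|]; first by case: (sP n).
by apply: (cv_to0_squeeze (cv_to_harmonic L mw0)) => n; case: (sP n).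
Qed.

Lemma cv_to_uniform_integral A : measurable A ->
  cv_to L (fun n => sint A (fn n)) (l A).
Proof.
by move=> mA; apply: (cv_to_dist (cv_to_harmonic L mw0)) => n; exact: lP.
Qed.

(* A defining sequence [gn] is compared with [fn] outside a set [B m] that
   carries almost all of the integrals of [gn]: there only [gn] contributes. *)
Lemma uniform_integral_uniq l' : is_pos_integral L LR mu f l' ->
  l' setT = l setT.
Proof.
move=> [gn [[gn_simple gn_cvg [gn_abs [B [B_fin _ [sB [sB_limsup sB0]]]]]]]].
move=> [s' [s'_sup s'0]]; apply/subr0_eq/vabs_le0.
(* The distance of the two integrals is bounded by [sB m] for each fixed [m], and these bounds tend
   to 0. *)
apply: cv_to_le (cv_to_cst L _) sB0 _ => m.
have [mB Bfin] := B_fin m.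
(* [A] has finite measure, so [gn] converges in measure on it; outside [A] every [fn n] vanishes. *)
pose A := B m `|` C.
have mA : measurable A by exact: measurableU.
have Afin : (mu A < +oo)%E by exact: content_finU.
have [E [mE nullE [s [s_sup s0]]]] := gn_cvg A mA Afin.
have mAE n : measurable (A `&` E n) by exact: measurableI.
have gf_simple n : simple (fun t => vabs (gn n t - fn n t)).
  exact/simple_abs/simpleB.
(* The terms are: the distances of both integrals to their limits, the integrals over the
   exceptional set [E n], and the uniform distance of [gn n] and [fn n] on the rest of [A]. *)
pose e n := s' n + n.+1%:R^-1 *: (fine (mu C) *: w) +
  (sint (A `&` E n) (fun t => vabs (gn n t)) +
   sint (A `&` E n) (fun t => vabs (fn n t))) +
  fine (mu A) *: (s n + n.+1%:R^-1 *: w).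
have s_ge0 n : 0 <= s n.
  by apply: is_vsup_ge0 (s_sup n) _ => _ [t _ <-]; exact: vabs_ge0.
have s'_ge0 n : 0 <= s' n.
  by apply: is_vsup_ge0 (s'_sup n) _ => _ [t _ <-]; exact: vabs_ge0.
have sint_abs_ge0 (h : T -> X) D : simple h -> measurable D ->
    0 <= sint D (fun t => vabs (h t)).
  move=> sh mD; apply: simple_integral_ge0 => // [|t _]; first exact: simple_abs.
  exact: vabs_ge0.
have harm_ge0 (n : nat) (u : X) : 0 <= u -> 0 <= n.+1%:R^-1 *: u.
  by move=> u0; rewrite vscale_ge0// invr_ge0.
have mBC : measurable (~` B m) by exact: measurableC.
apply: (le_limsup (e := e) (vabs_ge0 _) _ _ (sB_limsup m)) => [n|n||n].
- exact: sint_abs_ge0.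
- by rewrite /e !vaddr_ge0 ?sint_abs_ge0 ?harm_ge0 ?vscale_ge0 ?fine_content_ge0
    ?vaddr_ge0 ?harm_ge0.
- have -> : (0 : X) = 0 + 0 + (0 + 0) + fine (mu A) *: (0 + 0).
    by rewrite !addr0 scaler0 addr0.
  apply: cv_toD; first apply: cv_toD.
  + by apply: cv_toD => //; exact: cv_to_harmonic.
  (* The exceptional sets have measure tending to 0 within [A], and both sequences have
     equiabsolutely continuous integrals. *)
  + apply: cv_toD; first exact: gn_abs.
    by case: uniform_defining => _ _ [fn_abs _]; exact: fn_abs.
  + by apply: cv_toZ; apply: cv_toD => //; exact: cv_to_harmonic.
have gE : vabs (sint setT (gn n) - l' setT) <= s' n.
  by apply: (is_vsup_ub (s'_sup n)); exists setT => //; exact: measurableT.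
have fE := lP measurableT n.
have lD : vabs (l' setT - l setT) <= s' n + n.+1%:R^-1 *: (fine (mu C) *: w) +
    vabs (sint setT (gn n) - sint setT (fn n)).
  apply: le_trans (vabs_dist _ (sint setT (gn n)) _) _.
  rewrite -addrA vleD//; first by rewrite vabs_distC.
  apply: le_trans (vabs_dist _ (sint setT (fn n)) _) _.
  by rewrite addrC vleD.
apply: le_trans lD _; rewrite -simple_integralB//.
apply: le_trans (vleD (lexx _) (simple_integral_abs _ _)) _ => //.
  exact: simpleB.
rewrite (simple_integral_split (gf_simple n) measurableT mA) setTI.
rewrite (simple_integral_split (gf_simple n) mA (mE n)).
have h1 : sint (A `&` E n) (fun t => vabs (gn n t - fn n t)) <=
    sint (A `&` E n) (fun t => vabs (gn n t)) +
    sint (A `&` E n) (fun t => vabs (fn n t)).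
  rewrite -simple_integralD//; try exact: simple_abs.
  apply: simple_integral_le => // [|t _]; first by apply: simpleD; exact: simple_abs.
  by apply: le_trans (vabsD _ _) _; rewrite vabsN.
have h2 : sint (A `\` E n) (fun t => vabs (gn n t - fn n t)) <=
    fine (mu A) *: (s n + n.+1%:R^-1 *: w).
  have mAD : measurable (A `\` E n) by exact: measurableD.
  apply: le_trans (simple_integral_bound (x := s n + n.+1%:R^-1 *: w)
    (gf_simple n) mAD mA Afin _ _) _.
  - move=> t AEt _; apply: le_trans (vabs_dist _ (f t) _) _.
    apply: vleD; last by rewrite vabs_distC.
    by apply: (is_vsup_ub (s_sup n)); exists t.
  - by move=> t [At _] nAt; case: (nAt At).
  - apply: vscale_ler; first by rewrite vaddr_ge0 ?harm_ge0.
    by apply: fine_content_le => //; exact: measurableI.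
have h3 : sint (~` A) (fun t => vabs (gn n t - fn n t)) <=
    sint (~` B m) (fun t => vabs (gn n t)).
  have mAC : measurable (~` A) by exact: measurableC.
  apply: (@le_trans _ _ (sint (~` A) (fun t => vabs (gn n t)))).
    apply: simple_integral_le => //; first exact: simple_abs.
    by move=> t At; rewrite (fn_supp n) ?subr0// => Ct; apply: At; right.
  apply: simple_integral_subset => //; first exact: simple_abs.
    by move=> t At Bt; apply: At; left.
  by move=> t _; exact: vabs_ge0.
rewrite setTD /e [leRHS]addrC -2![leRHS]addrA; apply: vleD => //.
by rewrite -addrA; apply: vleD => //; exact: vleD.
Qed.

Lemma uniform_pos_integral : pos_integral L LR mu setT f = l setT.
Proof.
apply: xget_subset1; first by exists l; split=> //; exact: uniform_is_pos_integral.
by move=> _ _ [l1 [/uniform_integral_uniq -> ->]] [l2 [/uniform_integral_uniq -> ->]].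
Qed.

End uniform_approximation.

Section uniform_integrable.
Context {d : measure_display} {T : measurableType d} {R : realType}
  {X : dedekindVLatticeType R}
  (L : convergence X) (LR : convergence (R^o : dedekindVLatticeType R))
  (tripleRXX : product_triple LR L L (fun (r : R^o) (x : X) => (r : R) *: x))
  (mu : {content set T -> \bar R}).

Lemma uniform_pos_integrable (C : set T) (fn : nat -> T -> X) (f : T -> X)
    (w : X) :
  measurable C -> (mu C < +oo)%E -> 0 <= w -> (forall t, 0 <= f t) ->
  (forall n, simple mu (fn n)) -> (forall n t, ~ C t -> fn n t = 0) ->
  (forall n t, vabs (fn n t) <= w) ->
  (forall n t, vabs (fn n t - f t) <= n.+1%:R^-1 *: w) ->
  pos_integrable L LR mu f /\
  cv_to L (fun n => simple_integral mu setT (fn n)) (pos_integral L LR mu setT f).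
Proof.
move=> mC Cf w0 f0 sfn supp bnd cvg.
have [l lP] := uniform_integral_limit mC Cf w0 sfn supp cvg.
rewrite (uniform_pos_integral tripleRXX mC Cf w0 sfn supp bnd cvg lP); split.
  split=> //; exists l.
  exact: (uniform_is_pos_integral tripleRXX mC Cf w0 sfn supp bnd cvg lP).
exact: (cv_to_uniform_integral L w0 lP measurableT).
Qed.

End uniform_integrable.

(** * Step functions on tagged partitions *)

Section step_integral.
Context {d : measure_display} {T : measurableType d} {R : realType}
  (mu : {content set T -> \bar R}).

Import HBNNSimple.

(** The integral is by definition a difference of two suprema of [sintegral]; [k] competes in the
    first, and the second is 0 because [h] is nonnegative. *)
Lemma sintegral_le_integral (k : {nnsfun T >-> R}) (h : T -> R) :
  (forall t, 0 <= h t) -> (forall t, k t <= h t) ->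
  (sintegral mu k <= \int[mu]_(t in setT) (h t)%:E)%E.
Proof.
move=> h0 kh; have h0E t : (0 <= (h t)%:E)%E by rewrite lee_fin.
have hneg : (fun t => (h t)%:E)^\-%E = cst 0%E.
  by apply/funext => t; rewrite (ge0_funenegE (D := setT)) ?inE.
have hpos : (fun t => (h t)%:E)^\+%E = (fun t => (h t)%:E).
  by apply/funext => t; rewrite (ge0_funeposE (D := setT)) ?inE.
rewrite /integral patch_setT hneg hpos.
(* Every nonnegative simple function below the zero function vanishes, so the supremum for the
   negative part is 0. *)
rewrite [X in (_ <= _ - X)%E](_ : _ = 0%E); last first.
  have sint0 (k' : {nnsfun T >-> R}) : (forall t, (k' t)%:E <= 0)%E ->
      sintegral mu k' = 0%E.
    move=> k'0; rewrite /sintegral fsbig1// => x _.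
    have [->|x0] := eqVneq x 0; first by rewrite mul0e.
    rewrite preimage10 ?measure0 ?mule0// => -[t _ k't].
    move/negP: x0; apply; rewrite -k't eq_le fun_ge0 andbT.
    by have := k'0 t; rewrite lee_fin.
  apply/eqP; rewrite eq_le; apply/andP; split.
    by apply: ge_ereal_sup => _ [k' /= k'0 <-]; rewrite sint0.
  by apply: ereal_sup_ubound; exists nnsfun0 => //; exact: sint0.
rewrite sube0; apply: ereal_sup_ubound; exists k => //=.
Qed.

Section finite_support.
Variables (C : set T) (r : nat) (P : 'I_r -> set T) (a : 'I_r -> R).
Hypotheses (mP : forall p, measurable (P p)) (mC : measurable C)
  (Cfin : (mu C < +oo)%E) (PC : forall p, P p `<=` C) (a0 : forall p, 0 <= a p).

Definition step_nnsfun : {nnsfun T >-> R} :=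
  \big[add_nnsfun/nnsfun0]_(p < r) scale_nnsfun (indic_nnsfun R (mP p)) (a0 p).

Lemma step_nnsfunE t : step_nnsfun t = \sum_(p < r) a p * \1_(P p) t.
Proof.
by rewrite /step_nnsfun; elim/big_ind2: _ => [//|x g y k <- <-//|p _].
Qed.

(** [sintegral] sums over level sets, the right-hand side over the [P p]. Both are representations
    of one simple function with values in the vector lattice [R^o], so [simple_integralE] identifies
    the sums. *)
Lemma sintegral_step :
  sintegral mu step_nnsfun = (\sum_(p < r) fine (mu (P p)) * a p)%:E.
Proof.
pose k : T -> (R^o : dedekindVLatticeType R) := step_nnsfun.
have Pfin p : (mu (P p) < +oo)%E by exact: content_fin_sub (mP p) mC (@PC p) Cfin.
have kP : simple_repr mu (fun p => a p : R^o) P k.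
  by split=> [//|t]; rewrite /k step_nnsfunE; apply: eq_bigr => p _;
    rewrite mulrC.
have /finite_seqP[s0 s0E] := fimfunP step_nnsfun.
(* The value 0 is dropped: its level set may have infinite measure, which a simple representation
   does not allow. *)
pose s := [seq x <- undup s0 | x != 0].
have s_uniq : uniq s by rewrite filter_uniq// undup_uniq.
have mk x : measurable (step_nnsfun @^-1` [set x]) by [].
have kfin x : x != 0 -> (mu (step_nnsfun @^-1` [set x]) < +oo)%E.
  move=> x0; apply: content_fin_sub Cfin => // t /= kt.
  apply: contrapT => Ct; move/negP: x0; apply; rewrite -kt step_nnsfunE.
  by rewrite big1// => p _; rewrite indicE memNset ?mulr0// => /PC.
have ks : simple_repr mu (fun j => tnth (in_tuple s) j : R^o)
    (fun j => step_nnsfun @^-1` [set tnth (in_tuple s) j]) k.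
  split=> [j|t].
    split=> //; apply: kfin.
    by have := mem_tnth j (in_tuple s); rewrite mem_filter => /andP[].
  rewrite -(big_tnth _ _ s xpredT
    (fun x => (\1_(step_nnsfun @^-1` [set x]) t : R) *: (x : R^o))).
  have [kt0|kt0] := eqVneq (k t) 0.
    rewrite kt0 big_seq big1// => x; rewrite mem_filter => /andP[x0 _].
    by rewrite indicE memNset ?scale0r//= => /esym; rewrite -/(k t) kt0; exact/eqP.
  rewrite (bigD1_seq (k t))//=; last first.
    rewrite mem_filter kt0 mem_undup.
    have : [set` s0] (k t) by rewrite -s0E; exists t.
    by [].
  rewrite indicE mem_set// scale1r big1 ?addr0// => x xk.
  by rewrite indicE memNset ?scale0r//= => /esym; exact/eqP.
have := simple_integralE kP measurableT; rewrite (simple_integralE ks measurableT).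
under eq_bigr do rewrite setTI; under [RHS]eq_bigr do rewrite setTI.
move=> sumE; rewrite -[X in X%:E]sumE.
rewrite -(big_tnth _ _ s xpredT (fun x => fine (mu (step_nnsfun @^-1` [set x])) *: (x : R^o))).
(* The sum over all reals reduces to [s]: any other value is 0 or has an empty level set. *)
rewrite /sintegral -(fsbig_widen [set` s])//=.
  rewrite -fsbig_seq// -sumEFin big_seq [RHS]big_seq; apply: eq_bigr => x.
  rewrite mem_filter => /andP[x0 _].
  by rewrite -[in LHS]muleC EFinM fineK// ge0_fin_numE ?measure_ge0 ?kfin.
move=> x [_ /= xs]; have [->|x0] := eqVneq x 0; first by rewrite mul0e.
rewrite preimage10 ?measure0 ?mule0// => xr; apply: xs.
by rewrite /= mem_filter x0 mem_undup; rewrite s0E in xr.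
Qed.

(** By disjointness at most one term of the step function is nonzero at each point, so the step
    function stays below [h]. This is what bounds the total weight by the integral of [h]. *)
Lemma step_sum_le_integral (h : T -> R) : (forall t, 0 <= h t) ->
  (forall p q t, P p t -> P q t -> p = q) ->
  (forall p t, P p t -> a p <= h t) ->
  ((\sum_(p < r) fine (mu (P p)) * a p)%:E <= \int[mu]_(t in setT) (h t)%:E)%E.
Proof.
move=> h0 dP ah; rewrite -sintegral_step; apply: sintegral_le_integral => // t.
rewrite step_nnsfunE; have [[p Pt]|nPt] := pselect (exists p, P p t).
  rewrite (bigD1 p)//= indicE mem_set// mulr1 big1 ?addr0; first exact: ah.
  move=> q qp; rewrite indicE memNset ?mulr0// => Qt.
  by move/eqP: qp; apply; exact: dP Qt Pt.
by rewrite big1// => p _; rewrite indicE memNset ?mulr0// => Pt; apply: nPt; exists p.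
Qed.

End finite_support.
End step_integral.

Record step_data (R T : Type) := StepData {
  sd_size : nat ;
  sd_set : 'I_sd_size -> set T ;
  sd_height : 'I_sd_size -> R ;
  sd_tag : 'I_sd_size -> T
}.

Section step_functions.
Context {d : measure_display} {T : measurableType d} {R : realType}
  {X : dedekindVLatticeType R} (mu : {content set T -> \bar R}).
Variables (C : set T) (h : T -> R).

(** A tagged partition of [C] adapted to [h]. Heights approximate [h] from below, so that the total
    weight cannot exceed its integral. The relation [near] is left abstract; it later means
    closeness to the tag in the metric. *)
Definition step_approx (near : T -> T -> Prop) (eps : R) (q : step_data R T) :=
  [/\ forall p, measurable (sd_set (s := q) p) /\ sd_set p `<=` C,
      forall p, 0 <= sd_height (s := q) p,
      forall p p' t, sd_set (s := q) p t -> sd_set p' t -> p = p',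
      forall t, C t -> exists p, sd_set (s := q) p t &
      forall p t, sd_set (s := q) p t ->
        [/\ sd_height p <= h t, h t <= sd_height p + eps & near t (sd_tag p)]].

Definition step_fun (q : step_data R T) (F : T -> X) (t : T) : X :=
  \sum_p (\1_(sd_set p) t : R) *: (sd_height p *: F (sd_tag (s := q) p)).

Definition step_weight (q : step_data R T) p : R :=
  fine (mu (sd_set p)) * sd_height (s := q) p.

Definition step_sum (q : step_data R T) (F : T -> X) : X :=
  \sum_p step_weight p *: F (sd_tag (s := q) p).

Hypotheses (mC : measurable C) (Cfin : (mu C < +oo)%E).
Variables (near : T -> T -> Prop) (eps : R) (q : step_data R T).
Hypothesis qP : step_approx near eps q.

Lemma step_weight_ge0 p : 0 <= step_weight (q := q) p.
Proof. by case: qP => _ a0 _ _ _; rewrite mulr_ge0 ?fine_content_ge0. Qed.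

Lemma step_fun_in F p t : sd_set (s := q) p t ->
  step_fun q F t = sd_height p *: F (sd_tag p).
Proof.
case: qP => _ _ dP _ _ Pt; rewrite /step_fun (bigD1 p)//= indicE mem_set//.
rewrite scale1r big1 ?addr0// => p' p'p; rewrite indicE memNset ?scale0r//.
by move=> P't; move/eqP: p'p; apply; exact: dP P't Pt.
Qed.

Lemma step_fun_out F t : ~ C t -> step_fun q F t = 0.
Proof.
case: qP => mP _ _ _ _ Ct; rewrite /step_fun big1// => p _.
by rewrite indicE memNset ?scale0r// => Pt; apply: Ct; apply: (mP p).2.
Qed.

Lemma step_fun_repr F :
  simple_repr mu (fun p => sd_height p *: F (sd_tag p)) (sd_set (s := q))
    (step_fun q F).
Proof.
case: qP => mP _ _ _ _; split=> // p; have [mp pC] := mP p; split=> //.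
exact: content_fin_sub mp mC pC Cfin.
Qed.

Lemma simple_step_fun F : simple mu (step_fun q F).
Proof.
exists (sd_size q), (fun p => sd_height p *: F (sd_tag p)), (sd_set (s := q)).
exact: step_fun_repr.
Qed.

Lemma simple_integral_step_fun F :
  simple_integral mu setT (step_fun q F) = step_sum q F.
Proof.
rewrite (simple_integralE (step_fun_repr F) measurableT).
by apply: eq_bigr => p _; rewrite setTI scalerA.
Qed.

Section bounds.
Variables (M : R) (w : X) (F : T -> X).
Hypotheses (M0 : 0 <= M) (hM : forall t, C t -> h t <= M) (w0 : 0 <= w)
  (eps0 : 0 <= eps) (Fw : forall t, vabs (F t) <= w)
  (F_near : forall t s, near t s -> vabs (F t - F s) <= eps *: w)
  (F_supp : forall t, ~ C t -> F t = 0).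

(** The heights are at most [M]; the constant [M + 1] is taken to agree with the one in
    [step_fun_dist]. *)
Lemma step_fun_bound t : vabs (step_fun q F t) <= (M + 1) *: w.
Proof.
have M1 : 0 <= M + 1 by rewrite addr_ge0.
have [Ct|Ct] := pselect (C t); last first.
  by rewrite step_fun_out// vabs0 vscale_ge0.
case: qP => _ a0 _ /(_ t Ct)[p Pt] /(_ p t Pt)[ah _ _].
rewrite (step_fun_in _ Pt); apply: le_trans (vabs_scale_le _ (a0 p)) _.
apply: vscale_le2 => //; apply: (le_trans ah); apply: (le_trans (hM Ct)).
by rewrite lerDl.
Qed.

(** With height [a] and tag [s], the difference is [a (F s - F t) + (a - h t) F t]; the first term
    contributes [M] and the second 1 to the factor [M + 1]. *)
Lemma step_fun_dist t :
  vabs (step_fun q F t - h t *: F t) <= eps *: ((M + 1) *: w).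
Proof.
have M1 : 0 <= M + 1 by rewrite addr_ge0.
have [Ct|Ct] := pselect (C t); last first.
  by rewrite step_fun_out// F_supp// scaler0 subrr vabs0 !vscale_ge0.
case: qP => _ a0 _ /(_ t Ct)[p Pt] /(_ p t Pt)[ah ha ts].
rewrite (step_fun_in _ Pt).
apply: le_trans (vabs_dist _ (sd_height p *: F t) _) _.
rewrite !(scalerDl, scalerDr) scale1r.
have -> : sd_height p *: F (sd_tag p) - sd_height p *: F t =
    sd_height p *: (F (sd_tag p) - F t) by rewrite scalerBr.
(* The sign is moved onto [F t] so that the scalar is nonnegative, as [vabs_scale_le] requires. *)
have -> : sd_height p *: F t - h t *: F t = (h t - sd_height p) *: - F t.
  by rewrite scalerN -scaleNr opprB scalerBl.
apply: vleD.
  apply: le_trans (vabs_scale_le _ (a0 p)) _.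
  rewrite scalerA [eps * M]mulrC -scalerA vabs_distC.
  apply: vscale_le2 => //; last exact: F_near.
  - exact: le_trans ah (hM Ct).
  - exact: vscale_ge0.
apply: le_trans (vabs_scale_le _ _) _; first by rewrite subr_ge0.
by rewrite vabsN vscale_le2// ?subr_ge0// lerBlDl.
Qed.

End bounds.
End step_functions.

Section step_limit.
Context {d : measure_display} {T : measurableType d} {R : realType}
  {X : dedekindVLatticeType R}
  (L : convergence X) (LR : convergence (R^o : dedekindVLatticeType R))
  (tripleRXX : product_triple LR L L (fun (r : R^o) (x : X) => (r : R) *: x))
  (mu : {content set T -> \bar R}).
Variables (C : set T) (h : T -> R) (M : R) (w : X).
Variables (near : nat -> T -> T -> Prop) (q : nat -> step_data R T).
Hypotheses (mC : measurable C) (Cfin : (mu C < +oo)%E)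
  (h0 : forall t, 0 <= h t) (M0 : 0 <= M) (hM : forall t, C t -> h t <= M)
  (w0 : 0 <= w)
  (qP : forall n : nat, step_approx C h (near n) n.+1%:R^-1 (q n)).

(** As [h] is nonnegative, the positive part of [h F] is [h] times the positive part of [F], which
    inherits the bound, the modulus and the support of [F]. *)
Lemma step_pos_integral (F : T -> X) : (forall t, vabs (F t) <= w) ->
  (forall n t s, near n t s -> vabs (F t - F s) <= n.+1%:R^-1 *: w) ->
  (forall t, ~ C t -> F t = 0) ->
  pos_integrable L LR mu (fun t => vpos (h t *: F t)) /\
  cv_to L (fun n => step_sum mu (q n) (fun t => vpos (F t)))
    (pos_integral L LR mu setT (fun t => vpos (h t *: F t))).
Proof.
move=> Fw F_near F_supp; pose F' t := vpos (F t).
have -> : (fun t => vpos (h t *: F t)) = (fun t => h t *: F' t).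
  by apply/funext => t; rewrite vposZ.
have F'w t : vabs (F' t) <= w.
  by rewrite vabs_pos ?vpos_ge0//; exact: le_trans (vpos_abs _) (Fw t).
have F'_near n t s : near n t s -> vabs (F' t - F' s) <= n.+1%:R^-1 *: w.
  by move=> /F_near; apply: le_trans; exact: vpos_lip.
have F'_supp t : ~ C t -> F' t = 0 by move=> Ct; rewrite /F' F_supp// vpos0.
have eps0 (n : nat) : 0 <= n.+1%:R^-1 :> R by rewrite invr_ge0.
have W0 : 0 <= (M + 1) *: w by rewrite vscale_ge0// addr_ge0.
have [t|n|n t Ct|n t|n t|int lim] := uniform_pos_integrable tripleRXX
    (fn := fun n => step_fun (q n) F') (f := fun t => h t *: F' t) mC Cfin W0.
- by rewrite vscale_ge0// vpos_ge0.
- exact: (simple_step_fun mC Cfin (qP n)).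
- exact: (step_fun_out (qP n)).
- exact: (step_fun_bound (qP n) M0 hM w0 F'w).
- exact: (step_fun_dist (qP n) M0 hM w0 (eps0 n) F'w (F'_near n) F'_supp).
split=> //; apply: cv_to_eq lim => n.
exact: (simple_integral_step_fun mC Cfin (qP n)).
Qed.

(** The case of positive parts is applied to [F] and to [- F], and the two limits are subtracted. *)
Lemma step_integral_limit (F : T -> X) : (forall t, vabs (F t) <= w) ->
  (forall n t s, near n t s -> vabs (F t - F s) <= n.+1%:R^-1 *: w) ->
  (forall t, ~ C t -> F t = 0) ->
  vintegrable L LR mu (fun t => h t *: F t) /\
  cv_to L (fun n => step_sum mu (q n) F)
    (vintegral L LR mu setT (fun t => h t *: F t)).
Proof.
move=> Fw F_near F_supp.
have [int1 lim1] := step_pos_integral Fw F_near F_supp.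
have [t|n t s ts|t Ct|int2 lim2] := @step_pos_integral (fun t => - F t).
- by rewrite vabsN.
- by rewrite -opprD vabsN; exact: F_near.
- by rewrite F_supp// oppr0.
have negE : (fun t => vneg (h t *: F t)) = (fun t => vpos (h t *: - F t)).
  by apply/funext => t; rewrite scalerN.
rewrite /vintegrable /vintegral negE; split=> //.
apply: cv_to_eq (cv_toB lim1 lim2) => n.
rewrite /step_sum -sumrB; apply: eq_bigr => p _.
by rewrite -scalerBr -vnegE vpos_neg.
Qed.

End step_limit.

(** * Partitions of a compact set *)

Section compact_partition.
Context {R : realType} {G : pmetricType R}.
Implicit Types (C : set G) (e : R).

Lemma borel_compact C : compact C -> measurable (C : set (borel G)).
Proof.
move=> cC; rewrite -(setCK C); apply: measurableC.
apply: sub_sigma_algebra; apply: closed_openC; apply: compact_closed => //.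
exact: metric_hausdorff.
Qed.

(** Interiors of balls are open, so they serve both in the covering property and as Borel sets. *)
Lemma compact_net C e : compact C -> 0 < e ->
  exists s : seq G, forall t, C t -> exists2 x, x \in s & (ball x e)^° t.
Proof.
move=> cC e0; move: (cC); rewrite compact_cover.
move=> /(_ G C (fun x => (ball x e)^°)) [|t Ct|D _ CD].
- by move=> x _; exact: open_interior.
- by exists t => //; exact: nbhsx_ballx.
by exists (finmap.enum_fset D) => t /CD[x xD tx]; exists x.
Qed.

(** Points of [C] are sorted by a net ball containing them and by the level [k] with
    [k eps <= h < (k+1) eps]. The lower end of the level is the height, the centre of the ball is
    the tag. *)
Lemma exists_step_approx C (h : borel G -> R) (M eps e : R) : compact C ->
  measurable_fun setT h -> (forall t, 0 <= h t) -> 0 <= M ->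
  (forall t, C t -> h t <= M) -> 0 < eps -> 0 < e ->
  exists q, step_approx (T := borel G) C h
    (fun t s => mdist (t : G) (s : G) <= e) eps q.
Proof.
move=> cC mh h0 M0 hM eps0 e0; have [s sP] := compact_net cC e0.
(* Since [h <= M] on [C], the levels occurring there are [0], ..., [K - 1]. *)
pose K := (Num.truncn (M / eps)).+1.
pose S := [seq (x, k) | x <- s, k <- iota 0 K].
pose xk i := nth (point : G, 0%N) S i.
pose Q (i : nat) : set (borel G) := (C `&` (ball (xk i).1 e)^°) `&`
  [set t | (xk i).2%:R * eps <= h t < (xk i).2.+1%:R * eps].
have mQ i : measurable (Q i).
  apply: measurableI; first apply: measurableI.
  - exact: borel_compact.
  - by apply: sub_sigma_algebra; exact: open_interior.
  - have := mh measurableT `[(xk i).2%:R * eps, (xk i).2.+1%:R * eps[%classic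
      (measurable_itv _).
    by rewrite setTI; congr measurable; apply/seteqP; split=> t /=;
      rewrite in_itv.
(* [seqDU] removes from each [Q i] the earlier ones: the pieces become disjoint and keep the same
   union. For indices below [size S] the default value in [xk] is never reached. *)
exists (StepData (fun i : 'I_(size S) => seqDU Q i)
  (fun i : 'I_(size S) => (xk i).2%:R * eps)
  (fun i : 'I_(size S) => (xk i).1)); split=> /=.
- move=> p; split; last by move=> t [[[]]].
  by apply: measurableD => //; exact: bigsetU_measurable.
- by move=> p; rewrite mulr_ge0// ltW.
- move=> p p' t pt p't; apply/val_inj => /=.
  by apply: (trivIset_seqDU Q) => //; exists t.
- move=> t Ct; have [x xs tx] := sP t Ct.
  pose k := Num.truncn (h t / eps).
  have hte : 0 <= h t / eps by rewrite divr_ge0// ltW.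
  have kK : (k < K)%N.
    rewrite ltnS; apply: le_truncn.
    by rewrite ler_pM2r ?invr_gt0// hM.
  have xkS : (x, k) \in S by apply/allpairsP; exists (x, k); rewrite mem_iota.
  have Qt : Q (index (x, k) S) t.
    rewrite /Q /xk nth_index//=; split=> //.
    by rewrite -ler_pdivlMr// -ltr_pdivrMr// truncn_le hte truncnS_gt.
  have : (\big[setU/set0]_(i < size S) Q i) t.
    have iS : (index (x, k) S < size S)%N by rewrite index_mem.
    by rewrite (bigD1 (Ordinal iS))//=; left.
  by rewrite bigsetU_seqDU -bigcup_mkord => -[i /= iS Qit]; exists (Ordinal iS).
- move=> p t [[[_ tx]] /andP[ah ha] _]; split=> //.
    by rewrite (le_trans (ltW ha))// -natr1 mulrDl mul1r.
  by rewrite metric_sym ltW//; have := interior_subset tx; rewrite ballEmdist.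
Qed.

End compact_partition.

(** * Order boundedness of uniformly continuous functions vanishing off a compact set *)

Section vunif_continuous_theory.
Context {R : realType} {G : pmetricType R} {X : dedekindVLatticeType R}.

(** On [C], [f] is within [u] of its value at some point of a finite net; the sum of the absolute
    values over the net dominates each of them. *)
Lemma vunif_continuous_bounded (C : set G) (f : G -> X) : compact C ->
  vunif_continuous f -> (forall t, ~ C t -> f t = 0) ->
  exists2 u, 0 <= u & forall t, vabs (f t) <= u.
Proof.
move=> cC [u u0 fu] f_supp; have [e e0 fe] := fu 1 ltr01.
have [s sP] := compact_net cC e0.
have s0 : 0 <= \sum_(x <- s) vabs (f x) by apply: vsum_ge0 => x _; exact: vabs_ge0.
exists (u + \sum_(x <- s) vabs (f x)); first exact: vaddr_ge0.
move=> t; have [Ct|Ct] := pselect (C t); last first.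
  by rewrite f_supp// vabs0 vaddr_ge0.
have [x xs /interior_subset] := sP t Ct; rewrite ballEmdist/= => /ltW/fe fxt.
rewrite scale1r in fxt; rewrite -(subrK (f x) (f t)).
apply: le_trans (vabsD _ _) _; apply: vleD; first by rewrite vabs_distC.
rewrite (big_rem x)//= -{1}(addr0 (vabs (f x))) vleD// vsum_ge0// => y _.
exact: vabs_ge0.
Qed.

End vunif_continuous_theory.

(** * Jensen's inequality for step sums and the passage to the limit *)

Section jensen.
Context {d : measure_display} {T : measurableType d} {R : realType}
  {X : dedekindVLatticeType R} {L : convergence X} {mul : X -> X -> X}
  (algX : product_algebra L mul) (mu : {content set T -> \bar R}).

(* The missing mass [1 - \sum_p c_p] counts as the value [0] of [f]; since
   [phi 0 = 0], the tangent at [v] is nonpositive there. *)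
Lemma step_jensen (q : step_data R T) (phi : X -> X) (f : T -> X) (v b : X) :
  (forall p, 0 <= step_weight mu (q := q) p) ->
  \sum_p step_weight mu (q := q) p <= 1 -> phi 0 = 0 ->
  (forall s, phi v + mul b (s - v) <= phi s) ->
  phi v + mul b (step_sum mu q f - v) <= step_sum mu q (phi \o f).
Proof.
move=> c0 c1 phi0 tangent.
have h0 : phi v - mul b v <= 0.
  by have := tangent 0; rewrite phi0 sub0r (pmulNr algX).
apply: (@le_trans _ _ (\sum_p step_weight mu (q := q) p *:
    (phi v + mul b (f (sd_tag p) - v)))); last first.
  by apply: vle_sum => p _; apply: vscale_le.
have sub s : phi v + mul b (s - v) = phi v - mul b v + mul b s.
  by rewrite (pmulDr algX) (pmulNr algX) addrCA addrC.
rewrite sub; under eq_bigr do rewrite sub scalerDr -(pmulZr algX).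
rewrite big_split/= -scaler_suml -(pmul_sum algX) vleD2rE.
(* The constant [phi v - mul b v] is at most 0, so multiplying it by a total weight at most 1 can
   only increase it. *)
by rewrite -vleN2 -scalerN -{2}(scale1r (- _)) vscale_ler// -oppr0 vleN2.
Qed.

End jensen.

Theorem theorem3p26 (R : realType) (G : pmetricType R)
    (X : dedekindVLatticeType R)
    (L : convergence X) (LR : convergence (R^o : dedekindVLatticeType R))
    (mul : X -> X -> X)
    (algX : product_algebra L mul)
    (tripleRXX : product_triple LR L L (fun (r : R^o) (x : X) => (r : R) *: x))
    (tripleXRX : product_triple L LR L (fun (x : X) (r : R^o) => (r : R) *: x))
    (mu : {content set (borel G) -> \bar R})
    (mu_sigma_finite : sigma_finite setT mu)
    (mu_regular : regular mu)
    (C : set G) (compactC : compact C)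
    (phi : X -> X) (phi_convex : vconvex mul phi) (phi0 : phi 0 = 0)
    (f : G -> X) (f_uc : vunif_continuous f)
    (f_supp : forall g, ~ C g -> f g = 0)
    (h : G -> R) (h_ge0 : forall g, 0 <= h g)
    (h_int : mu.-integrable setT (EFin \o (h : borel G -> R)))
    (h_int1 : (\int[mu]_(g in setT) (h g)%:E = 1)%E)
    (h_bnd : forall B : set (borel G), measurable B -> (mu B < +oo)%E ->
       exists M : R, forall g, B g -> h g <= M) :
  [/\ vintegrable L LR mu (fun g : borel G => h g *: f g),
      vintegrable L LR mu (fun g : borel G => h g *: phi (f g)) &
      phi (vintegral L LR mu setT (fun g : borel G => h g *: f g)) <=
      vintegral L LR mu setT (fun g : borel G => h g *: phi (f g))].
Proof.
have mC := borel_compact compactC.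
have Cfin : (mu C < +oo)%E by exact: mu_regular.1.
have mh : measurable_fun setT (h : borel G -> R).
  by apply/measurable_EFinP; case/integrableP: h_int.
have [M0' hM0'] := h_bnd C mC Cfin.
pose M := Num.max 0 M0'.
have M0 : 0 <= M by rewrite le_max lexx.
have hM t : C t -> h t <= M by move=> /hM0' ht; rewrite le_max ht orbT.
have [u0 u00 fu0] := vunif_continuous_bounded compactC f_uc f_supp.
have [B B0 phi_lip] := vconvex_lipschitz algX phi_convex u00.
have [u u_ge0 fu] := f_uc.
(* A single [w] dominates the bound [u0] and the modulus [u] of [f], and also their images under
   [mul B], which by the Lipschitz estimate control [phi \o f]. *)
pose w := (u0 + u) + mul B (u0 + u).
have uu0 : 0 <= u0 + u by exact: vaddr_ge0.
have Buu0 : 0 <= mul B (u0 + u) by exact: (pmul_ge0 algX).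
have w0 : 0 <= w by exact: vaddr_ge0.
have le_w x : x <= u0 + u -> x <= w by move=> xu; rewrite -(addr0 x) vleD.
have le_Bw x : x <= mul B (u0 + u) -> x <= w by move=> xu; rewrite -(add0r x) vleD.
have u0_le : u0 <= u0 + u by rewrite -{1}(addr0 u0) vleD.
have u_le : u <= u0 + u by rewrite -{1}(add0r u) vleD.
have phif_supp t : ~ C t -> phi (f t) = 0 by move=> Ct; rewrite f_supp.
have fw t : vabs (f t) <= w by apply: le_w; exact: le_trans (fu0 t) _.
have phifw t : vabs (phi (f t)) <= w.
  (* Because [phi 0 = 0], the Lipschitz estimate between [f t] and 0 bounds [phi (f t)] itself. *)
  apply: le_Bw; rewrite -(subr0 (phi (f t))) -phi0.
  apply: le_trans (phi_lip _ _ (fu0 t) _) _; first by rewrite vabs0.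
  by rewrite subr0; apply: (pt_monor algX) => //; exact: le_trans (fu0 t) _.
have eps0 (n : nat) : 0 < n.+1%:R^-1 :> R by rewrite invr_gt0 ltr0n.
have /choice[dl dlP] : forall n : nat, exists dl : R, 0 < dl /\
    forall g1 g2 : G, mdist g1 g2 <= dl -> vabs (f g1 - f g2) <= n.+1%:R^-1 *: u.
  by move=> n; have [dl dl0 dlP] := fu _ (eps0 n); exists dl.
pose near n (t s : borel G) := mdist (t : G) (s : G) <= dl n.
have f_near n t s : near n t s -> vabs (f t - f s) <= n.+1%:R^-1 *: w.
  move=> /(dlP n).2 /le_trans; apply; apply: vscale_le; first exact/ltW.
  exact: le_w.
have phif_near n t s : near n t s ->
    vabs (phi (f t) - phi (f s)) <= n.+1%:R^-1 *: w.
  move=> /(dlP n).2 ts; apply: le_trans (phi_lip _ _ (fu0 t) (fu0 s)) _.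
  apply: le_trans (pt_monor algX B0 ts) _; rewrite (pmulZr algX).
  apply: vscale_le; first exact/ltW.
  by apply: le_Bw; exact: (pt_monor algX).
(* The same partitions are used for both integrands, so that the two step sums can be compared for
   each [n]. *)
have /choice[q qP] : forall n : nat, exists q : step_data R (borel G),
    step_approx (T := borel G) C h (near n) n.+1%:R^-1 q.
  by move=> n; exact: (exists_step_approx compactC mh h_ge0 M0 hM (eps0 n) (dlP n).1).
have [f_int f_lim] := step_integral_limit tripleRXX mC Cfin h_ge0 M0 hM w0 qP
  fw f_near f_supp.
have [phif_int phif_lim] := step_integral_limit tripleRXX mC Cfin h_ge0 M0 hM w0 qP
  phifw phif_near phif_supp.
split=> //; set v := vintegral _ _ _ _ _ in f_lim *.
have [beta [tangent _]] := phi_convex.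
(* The tangent is taken at the limit [v] with a slope independent of [n], so continuity of the
   product in its second factor makes the linear term tend to 0. *)
have lim0 : cv_to L (fun n => phi v + mul (beta v) (step_sum mu (q n) f - v)) (phi v).
  rewrite -{2}(addr0 (phi v)); apply: cv_toD; first exact: cv_to_cst.
  apply: (pt_cvr algX); rewrite -(subrr v); apply: cv_toB => //; exact: cv_to_cst.
apply: (cv_to_le lim0 phif_lim) => n; apply: (step_jensen algX) => //.
- by move=> p; exact: (step_weight_ge0 mu (qP n)).
(* The heights are lower bounds of [h], so the total weight is at most its integral, which is 1. *)
have [mP a0 dP _ ha] := qP n.
rewrite -lee_fin -h_int1.
apply: (step_sum_le_integral _ mC Cfin) => //.
- by move=> p; case: (mP p).
- by move=> p; case: (mP p).
- by move=> p t /ha[].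
Qed.
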